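(* Let $n\ge 1$ and $N\ge 3n$, and let $W = \operatorname{Hom}(\mathbb{R}^n\oplus\operatorname{Sym}^2(\mathbb{R}^n)\oplus\operatorname{Sym}^3(\mathbb{R}^n),\mathbb{R}^N)$, viewed as the space of triples $(L,B,T)$ of a linear map $L:\mathbb{R}^n\to\mathbb{R}^N$, a symmetric bilinear map $B:\mathbb{R}^n\times\mathbb{R}^n\to\mathbb{R}^N$ and a symmetric trilinear map $T:(\mathbb{R}^n)^3\to\mathbb{R}^N$. Let $\mathcal{Y}\subseteq W$ be the set of triples $(L,B,T)$ for which there exist $v_3\in\mathbb{R}^n$ with $v_3\neq 0$ and $(v_1,v_2,\lambda)\in\mathbb{R}^n\oplus\mathbb{R}^n\oplus\mathbb{R}$ with $(v_1,v_2,\lambda)\neq 0$ such that $$L(v_1)+B(v_2,v_3)+\lambda T(v_3,v_3,v_3)=0$$ (equivalently, the polynomial map $x\mapsto L(x)+\tfrac12B(x,x)+\tfrac16T(x,x,x)$ fails the local condition at $x=0$). Then $\mathcal{Y}$ is a closed semialgebraic subset of $W$ of codimension $N-3n+1$, i.e. $\dim W - \dim\mathcal{Y} = N-3n+1$.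
   Context: A smooth map $g:\mathbb{R}^n\to\mathbb{R}^N$ satisfies the local condition at $a$ if every solution $(v_1,v_2,v_3,\lambda)\in\mathbb{R}^n\times\mathbb{R}^n\times\mathbb{R}^n\times\mathbb{R}$ of $Dg_a(v_1)+D^2g_a(v_2,v_3)+\lambda D^3g_a(v_3,v_3,v_3)=0$ with $v_3\neq 0$ has $v_1=0$, $v_2=0$, $\lambda=0$, where $D^kg_a$ is the symmetric $k$-linear map of $k$-th order partial derivatives at $a$. Dimension of a semialgebraic set is the usual semialgebraic dimension. *)

(* Defs.v *)
From HB Require Import structures.
From mathcomp Require Import all_boot all_order all_algebra.
From mathcomp Require Import all_classical all_reals all_analysis.
Set Implicit Arguments. Unset Strict Implicit. Unset Printing Implicit Defensive.
Import Order.TTheory GRing.Theory Num.Theory.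
Import numFieldNormedType.Exports.
Local Open Scope classical_set_scope.
Local Open Scope ring_scope.

Inductive pexpr (R : Type) (m : nat) : Type :=
  | PVar of 'I_m
  | PConst of R
  | PAdd of pexpr R m & pexpr R m
  | PMul of pexpr R m & pexpr R m
  | POpp of pexpr R m.

Fixpoint peval (R : pzRingType) (m : nat) (p : pexpr R m) (x : 'rV[R]_m) : R :=
  match p with
  | PVar i => x 0 i
  | PConst c => c
  | PAdd p q => peval p x + peval q x
  | PMul p q => peval p x * peval q x
  | POpp p => - peval p x
  end.

Fixpoint pvars_in (R : Type) (m : nat) (I : {set 'I_m}) (p : pexpr R m) : bool :=
  match p with
  | PVar i => i \in I
  | PConst _ => true
  | PAdd p q => pvars_in I p && pvars_in I q
  | PMul p q => pvars_in I p && pvars_in I q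
  | POpp p => pvars_in I p
  end.

Inductive semialgebraic (R : realType) (m : nat) : set 'rV[R]_m -> Prop :=
  | sa_pos (p : pexpr R m) : semialgebraic [set x | 0 < peval p x]
  | sa_zero (p : pexpr R m) : semialgebraic [set x | peval p x = 0]
  | sa_union A B : semialgebraic A -> semialgebraic B -> semialgebraic (A `|` B)
  | sa_inter A B : semialgebraic A -> semialgebraic B -> semialgebraic (A `&` B)
  | sa_compl A : semialgebraic A -> semialgebraic (~` A).

(** * Dimension of a semialgebraic set: dimension of its Zariski closure,
    i.e. the transcendence degree of (each component of) its coordinate ring,
    i.e. the largest number of coordinate functions that are algebraically
    independent on S (no nonzero polynomial in them vanishes on S). *)
Definition coord_indep (R : realType) (m : nat) (S : set 'rV[R]_m)
    (I : {set 'I_m}) : Prop :=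
  forall p : pexpr R m, pvars_in I p ->
    (forall x, S x -> peval p x = 0) -> forall x, peval p x = 0.

Definition sa_dim (R : realType) (m : nat) (S : set 'rV[R]_m) : nat :=
  \max_(I : {set 'I_m} | `[< coord_indep S I >]) #|I|.

(** * The space W = Hom(R^n ⊕ Sym^2 R^n ⊕ Sym^3 R^n, R^N), embedded in the
    coordinate space of all (not nec. symmetric) triples (L, B, T). *)
Definition Widx (n N : nat) : finType :=
  ('I_N * (('I_n + 'I_n * 'I_n) + 'I_n * 'I_n * 'I_n))%type.

Definition Wdim (n N : nat) : nat := #|Widx n N|.

Definition wcoord (R : realType) (n N : nat) (w : 'rV[R]_(Wdim n N))
    (k : Widx n N) : R := w 0 (enum_rank k).

Definition Lmap (R : realType) (n N : nat) (w : 'rV[R]_(Wdim n N))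
    (v : 'rV[R]_n) : 'rV[R]_N :=
  \row_i \sum_j wcoord w (i, inl (inl j)) * v 0 j.

Definition Bmap (R : realType) (n N : nat) (w : 'rV[R]_(Wdim n N))
    (u v : 'rV[R]_n) : 'rV[R]_N :=
  \row_i \sum_j \sum_k wcoord w (i, inl (inr (j, k))) * u 0 j * v 0 k.

Definition Tmap (R : realType) (n N : nat) (w : 'rV[R]_(Wdim n N))
    (u v x : 'rV[R]_n) : 'rV[R]_N :=
  \row_i \sum_j \sum_k \sum_l
    wcoord w (i, inr (j, k, l)) * u 0 j * v 0 k * x 0 l.

(** W: B symmetric, T symmetric (invariant under the transpositions
    generating S_3). *)
Definition Wset (R : realType) (n N : nat) : set 'rV[R]_(Wdim n N) :=
  [set w | (forall i j k, wcoord w (i, inl (inr (j, k))) =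
                          wcoord w (i, inl (inr (k, j)))) /\
           (forall i j k l, wcoord w (i, inr (j, k, l)) =
                            wcoord w (i, inr (k, j, l))) /\
           (forall i j k l, wcoord w (i, inr (j, k, l)) =
                            wcoord w (i, inr (j, l, k)))].

Definition Yset (R : realType) (n N : nat) : set 'rV[R]_(Wdim n N) :=
  [set w | @Wset R n N w /\
     exists (v3 v1 v2 : 'rV[R]_n) (lam : R),
       v3 != 0 /\ ~ (v1 = 0 /\ v2 = 0 /\ lam = 0) /\
       Lmap w v1 + Bmap w v2 v3 + lam *: Tmap w v3 v3 v3 = 0].

(* Main.v *)
Require Import Defs.
From HB Require Import structures.
From mathcomp Require Import all_boot all_order all_algebra.
From mathcomp Require Import all_classical all_reals all_analysis.
From mathcomp Require Import ring zify.
From mathcomp.real_closed Require ordered_qelim qe_rcf.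
Import Order.TTheory GRing.Theory Num.Theory.
Import numFieldNormedType.Exports.
Local Open Scope classical_set_scope.
Local Open Scope ring_scope.
Set Implicit Arguments. Unset Strict Implicit. Unset Printing Implicit Defensive.

(** Fixing one nonzero coordinate of [v3] and one of [(v1, v2, lam)] to be 1,
    the [N] equations can be solved for the [N] components of one coefficient of
    [L], [B] or [T]; so [Y] is a finite union of polynomial images of spaces of
    dimension [dim W - N + (3 n - 1)], which bounds its dimension by counting
    monomials. Conversely, at the point of [Y] where [v3 = e_0], [lam = 1],
    [v1 = v2 = 0] and the vectors [L(e_a)], [B(e_0, e_a)], [T(e_0, e_0, e_a)]
    for [a > 0] are independent, the tangent directions of [Y] project onto all
    coordinates of [W] but [N - 3 n + 1], so no nonzero polynomial in these
    coordinates vanishes on [Y]. Semialgebraicity is quantifier elimination, and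
    closedness holds because [v3] and [(v1, v2, lam)] may be normalized into a
    compact set. *)

(** * Polynomial expressions *)

Arguments PVar {R m} _.
Arguments PConst {R m} _.

(** The constant [3 n - 1] counts the [3 n + 1] unknowns [(v3, v1, v2, lam)] up to the two scalings
    of the equation: that of [v3], compensated in [v2] and [lam], and that of [(v1, v2, lam)].
    Solving for a coefficient meets an obstacle: by symmetry the entry [B(e_j, e_k)] with [j <> k]
    occurs twice, with total factor [v2_k v_j + v2_j v_k], which may vanish even when
    [v_j = v2_k = 1]; so the normalized coordinates cannot be arbitrary nonzero ones. In the other
    direction, no implicit function theorem is called for: freezing [lam] and the first coordinate
    of [v3] at 1 makes the factor of [T(e_0, e_0, e_0)] constantly 1, so solving for this vector
    turns polynomial motions of the other coefficients and unknowns into polynomial curves inside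
    [Y]. *)

Fixpoint pmap (A B : Type) (m : nat) (f : A -> B) (p : pexpr A m) : pexpr B m :=
  match p with
  | PVar i => PVar i
  | PConst c => PConst (f c)
  | PAdd p q => PAdd (pmap f p) (pmap f q)
  | PMul p q => PMul (pmap f p) (pmap f q)
  | POpp p => POpp (pmap f p)
  end.

Fixpoint psubst (A : Type) (m d : nat) (s : 'I_m -> pexpr A d) (p : pexpr A m)
    : pexpr A d :=
  match p with
  | PVar i => s i
  | PConst c => PConst c
  | PAdd p q => PAdd (psubst s p) (psubst s q)
  | PMul p q => PMul (psubst s p) (psubst s q)
  | POpp p => POpp (psubst s p)
  end.

(** A syntactic upper bound for the total degree: cancellations are ignored. *)
Fixpoint pdeg (A : Type) (m : nat) (p : pexpr A m) : nat :=
  match p with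
  | PVar _ => 1%N
  | PConst _ => 0%N
  | PAdd p q => maxn (pdeg p) (pdeg q)
  | PMul p q => (pdeg p + pdeg q)%N
  | POpp p => pdeg p
  end.

Fixpoint ppow (A : pzRingType) (m : nat) (p : pexpr A m) (k : nat) : pexpr A m :=
  if k is k'.+1 then PMul p (ppow p k') else PConst 1.

Definition psum (A : pzRingType) (m : nat) (T : finType) (F : T -> pexpr A m) :=
  \big[@PAdd A m/PConst 0]_t F t.

Definition pprod (A : pzRingType) (m : nat) (T : finType) (F : T -> pexpr A m) :=
  \big[@PMul A m/PConst 1]_t F t.

Section PexprBasics.
Variables (A : pzRingType) (m : nat).
Implicit Types (p q : pexpr A m) (x y : 'rV[A]_m) (I : {set 'I_m}).

Lemma peval_eq_on I p x y :
  pvars_in I p -> (forall i, i \in I -> x 0 i = y 0 i) -> peval p x = peval p y.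
Proof.
move=> + xy; elim: p => //= [p IHp q IHq|p IHp q IHq|p IHp].
- by move=> /andP[/IHp -> /IHq ->].
- by move=> /andP[/IHp -> /IHq ->].
- by move=> /IHp ->.
Qed.

Lemma peval_ppow p k x : peval (ppow p k) x = peval p x ^+ k.
Proof. by elim: k => //= k ->; rewrite exprS. Qed.

Lemma pdeg_ppow p k : (pdeg (ppow p k) <= k * pdeg p)%N.
Proof. by elim: k => //= k; rewrite mulSn leq_add2l. Qed.

Lemma pvars_in_ppow I p k : pvars_in I p -> pvars_in I (ppow p k).
Proof. by move=> Ip; elim: k => //= k ->; rewrite Ip. Qed.

Lemma peval_psum (T : finType) (F : T -> pexpr A m) x :
  peval (psum F) x = \sum_t peval (F t) x.
Proof. by apply: (big_morph (fun p => peval p x)). Qed.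

Lemma pvars_in_psum I (T : finType) (F : T -> pexpr A m) :
  (forall t, pvars_in I (F t)) -> pvars_in I (psum F).
Proof. by move=> IF; apply: (big_ind (fun p => pvars_in I p)) => //= p q -> ->. Qed.

Lemma pdeg_psum (T : finType) (F : T -> pexpr A m) d :
  (forall t, pdeg (F t) <= d)%N -> (pdeg (psum F) <= d)%N.
Proof. by move=> Fd; apply: (big_ind (fun p => pdeg p <= d)%N) => //= p q; rewrite geq_max => -> ->. Qed.

Lemma peval_pprod (T : finType) (F : T -> pexpr A m) x :
  peval (pprod F) x = \prod_t peval (F t) x.
Proof. by apply: (big_morph (fun p => peval p x)). Qed.

Lemma pvars_in_pprod I (T : finType) (F : T -> pexpr A m) :
  (forall t, pvars_in I (F t)) -> pvars_in I (pprod F).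
Proof. by move=> IF; apply: (big_ind (fun p => pvars_in I p)) => //= p q -> ->. Qed.

Lemma pdeg_pprod (T : finType) (F : T -> pexpr A m) d :
  (forall t, pdeg (F t) <= d)%N -> (pdeg (pprod F) <= #|T| * d)%N.
Proof.
move=> Fd; rewrite -sum_nat_const.
by apply: (big_ind2 (fun p e => pdeg p <= e)%N) => //= *; exact: leq_add.
Qed.

Variable d : nat.

Lemma peval_psubst (s : 'I_m -> pexpr A d) p (y : 'rV[A]_d) :
  peval (psubst s p) y = peval p (\row_i peval (s i) y).
Proof. by elim: p => //= [i|p -> q ->|p -> q ->|p ->] //; rewrite mxE. Qed.

Lemma pvars_in_psubst (J : {set 'I_d}) (s : 'I_m -> pexpr A d) p :
  (forall i, pvars_in J (s i)) -> pvars_in J (psubst s p).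
Proof. by move=> Js; elim: p => //= p -> q ->. Qed.

Lemma pdeg_psubst (s : 'I_m -> pexpr A d) p e :
  (forall i, pdeg (s i) <= e)%N -> (pdeg (psubst s p) <= pdeg p * e)%N.
Proof.
move=> se; elim: p => //= [i|p IHp q IHq|p IHp q IHq].
- by rewrite mul1n.
- by rewrite maxnMl geq_max !leq_max IHp IHq orbT.
- by rewrite mulnDl leq_add.
Qed.

End PexprBasics.

Lemma peval_pmap (A B : pzRingType) (m : nat) (f : {rmorphism A -> B})
    (p : pexpr A m) (x : 'rV[A]_m) :
  peval (pmap f p) (map_mx f x) = f (peval p x).
Proof.
by elim: p => //= [i|p -> q ->|p -> q ->|p ->];
  rewrite ?mxE ?(rmorphD, rmorphM, rmorphN).
Qed.

Lemma pmap_comp (A B C : Type) (m : nat) (g : B -> C) (f : A -> B)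
    (p : pexpr A m) : pmap g (pmap f p) = pmap (g \o f) p.
Proof. by elim: p => //= [p -> q ->|p -> q ->|p ->]. Qed.

Lemma eq_pmap (A B : Type) (m : nat) (f g : A -> B) (p : pexpr A m) :
  f =1 g -> pmap f p = pmap g p.
Proof. by move=> fg; elim: p => //= [c|p -> q ->|p -> q ->|p ->]; rewrite ?fg. Qed.

Section PolyPoint.
Variables (A : comNzRingType) (m : nat).
Implicit Types (p : pexpr A m) (X : 'rV[{poly A}]_m).

Lemma horner_peval p X t :
  (peval (pmap polyC p) X).[t] = peval p (\row_i (X 0 i).[t]).
Proof.
by elim: p => //= [i|c|p IHp q IHq|p IHp q IHq|p IHp];
  rewrite ?mxE ?(hornerC, hornerD, hornerM, hornerN) ?IHp ?IHq.
Qed.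

Lemma size_peval p X :
  (forall i, size (X ord0 i) <= 2)%N ->
  (size (peval (pmap polyC p) X) <= (pdeg p).+1)%N.
Proof.
move=> X2; elim: p => //= [c|p IHp q IHq|p IHp q IHq|p IHp].
- by rewrite size_polyC leq_b1.
- by rewrite (leq_trans (size_polyD _ _))// geq_max -!maxnSS !leq_max IHp IHq orbT.
- apply: leq_trans (size_polyMleq _ _) _.
  by move: (size _) (size _) IHp IHq => a b; lia.
- by rewrite size_polyN.
Qed.

End PolyPoint.

(** * Real polynomial functions: zeros on grids, products, finite unions *)

Section RealPexpr.
Variable R : realType.

Lemma uniq_natr (k : nat) : uniq [seq i%:R : R | i <- iota 0 k].
Proof. by rewrite map_inj_uniq ?iota_uniq// => i j /eqP; rewrite eqr_nat => /eqP. Qed.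

Lemma poly_natr_eq0 (P : {poly R}) (k : nat) : (size P <= k)%N ->
  (forall i, (i < k)%N -> P.[i%:R] = 0) -> P = 0.
Proof.
move=> Pk P0; apply: (roots_geq_poly_eq0 _ (uniq_natr k)).
  by apply/allP => _ /mapP[i + ->]; rewrite mem_iota => /P0 /eqP.
by rewrite size_map size_iota.
Qed.

Lemma poly_fun_eq0 (P : {poly R}) : (forall t, P.[t] = 0) -> P = 0.
Proof. by move=> P0; exact: (poly_natr_eq0 (leqnn _)). Qed.

Variable m : nat.
Implicit Types (p q : pexpr R m) (x y : 'rV[R]_m).

Lemma peval_grid_eq0 p k : (pdeg p < k)%N ->
  (forall g : 'I_m -> nat, (forall i, g i < k)%N -> peval p (\row_i (g i)%:R) = 0) ->
  forall x, peval p x = 0.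
Proof.
move=> pk p0.
(* Coordinates are freed one at a time: those in [s] are arbitrary, the others stay in the grid.
   Along coordinate [j], a polynomial of size at most [k] has [k] roots. *)
suff H (s : seq 'I_m) : forall x (g : 'I_m -> nat), (forall i, g i < k)%N ->
    (forall i, i \notin s -> x 0 i = (g i)%:R) -> peval p x = 0.
  move=> x; apply: (H (enum 'I_m) x (fun=> 0%N)) => i; first by case: k pk {p0 H}.
  by rewrite mem_enum.
elim: s => [|j s IHs] x g gk xg.
  rewrite -[RHS](p0 _ gk); congr peval; apply/rowP => i.
  by rewrite mxE xg.
pose X t := \row_i (if i == j then t else x 0 i).
pose P := peval (pmap polyC p) (\row_i (if i == j then 'X else (x 0 i)%:P)).
have PE t : P.[t] = peval p (X t).
  rewrite horner_peval; congr peval; apply/rowP => i; rewrite !mxE.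
  by case: eqP; rewrite (hornerX, hornerC).
have -> : x = X (x 0 j) by apply/rowP => i; rewrite mxE; case: eqP => // ->.
rewrite -PE (_ : P = 0) ?horner0//; apply: (@poly_natr_eq0 _ k).
  apply: leq_trans pk; apply: size_peval => i; rewrite mxE.
  by case: eqP; rewrite ?size_polyX// size_polyC; case: eqP.
move=> i ik; rewrite PE; apply: (IHs _ (fun l => if l == j then i else g l)).
  by move=> l; case: eqP.
move=> l ls; rewrite mxE; case: eqP => // /eqP lj.
by rewrite xg// inE (negbTE lj).
Qed.

(** Restrict both factors to the line through a point where [p] is nonzero and one where [q] is
    nonzero; [{poly R}] is an integral domain. *)
Lemma peval_mul_eq0 p q : (forall x, peval p x * peval q x = 0) ->
  (forall x, peval p x = 0) \/ (forall x, peval q x = 0).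
Proof.
move=> pq0; apply: contrapT => /not_orP[/existsNP[x px] /existsNP[y qy]].
pose Z : 'rV[{poly R}]_m := \row_i ((x 0 i)%:P + (y 0 i - x 0 i)%:P * 'X).
have Z0 : \row_i (Z 0 i).[0] = x.
  by apply/rowP => i; rewrite !mxE hornerD hornerM hornerX !hornerC mulr0 addr0.
have Z1 : \row_i (Z 0 i).[1] = y.
  by apply/rowP => i; rewrite !mxE hornerD hornerM hornerX !hornerC mulr1 addrC subrK.
have : peval (pmap polyC p) Z * peval (pmap polyC q) Z = 0.
  by apply: poly_fun_eq0 => t; rewrite hornerM !horner_peval pq0.
move=> /eqP; rewrite mulf_eq0 => /orP[] /eqP e0.
- by apply: px; rewrite -Z0 -horner_peval e0 horner0.
- by apply: qy; rewrite -Z1 -horner_peval e0 horner0.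
Qed.

Lemma peval_prod_eq0 (T : finType) (F : T -> pexpr R m) :
  (forall x, peval (pprod F) x = 0) -> exists t, forall x, peval (F t) x = 0.
Proof.
rewrite /pprod; elim: (index_enum T) => [|t s IHs].
  by rewrite big_nil => /(_ 0) /= /eqP; rewrite oner_eq0.
by rewrite big_cons => /peval_mul_eq0[|/IHs//]; exists t.
Qed.

(** Otherwise each piece has a nonzero polynomial in the coordinates [I] vanishing on it; their
    product vanishes on [S], hence everywhere, and then so does one factor. *)
Lemma coord_indep_bigcup (T : finType) (Z : T -> set 'rV[R]_m) S I :
  S `<=` \bigcup_t Z t -> coord_indep S I -> exists t, coord_indep (Z t) I.
Proof.
move=> SZ SI; apply: contrapT => /forallNP ZI.
have /choice[F F_] t : exists p, [/\ pvars_in I p,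
    forall x, Z t x -> peval p x = 0 & ~ forall x, peval p x = 0].
  move: (ZI t) => /existsNP[p /not_implyP[Ip /not_implyP[Zp p0]]].
  by exists p.
have [|t] := @peval_prod_eq0 T F; last by case: (F_ t).
apply: SI => [|x /SZ [t _ Ztx]].
  by apply: pvars_in_pprod => t; case: (F_ t).
by rewrite peval_pprod (bigD1 t)//=; case: (F_ t) => _ -> //; rewrite mul0r.
Qed.

End RealPexpr.

(** * Dimension of a polynomial image *)

Lemma digits_inj (k a : nat) (f g : 'I_a -> nat) :
  (forall i, f i < k)%N -> (forall i, g i < k)%N ->
  (\sum_i f i * k ^ i)%N = (\sum_i g i * k ^ i)%N -> f =1 g.
Proof.
elim: a f g => [|a IHa] f g fk gk; first by move=> _ [].
rewrite !big_ord_recl /= expn0 !muln1.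
have shift (h : 'I_a.+1 -> nat) :
    (\sum_(i < a) h (lift ord0 i) * k ^ lift ord0 i =
     (\sum_(i < a) h (lift ord0 i) * k ^ i) * k)%N.
  rewrite big_distrl; apply: eq_bigr => i _ /=.
  by rewrite /bump leq0n add1n expnS mulnCA mulnC.
rewrite !shift => fg.
have k0 : (0 < k)%N by apply: leq_ltn_trans (fk ord0).
have fg0 : f ord0 = g ord0.
  by have := congr1 (modn^~ k) fg; rewrite ![(_ ord0 + _)%N]addnC !modnMDl !modn_small.
move: fg; rewrite fg0 => /addnI/eqP; rewrite eqn_pmul2r// => /eqP fg.
move=> i; case: (unliftP ord0 i) => [j|] ->//.
exact: (IHa (fun j => f (lift ord0 j)) (fun j => g (lift ord0 j))).
Qed.

Section Counting.
Variable R : realType.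

(* Kronecker substitution: at [x_i = t ^ (k ^ i)] distinct monomials become
   distinct powers of [t]. *)
Lemma monomials_indep (T : finType) (k : nat) (c : {ffun T -> 'I_k} -> R) :
  (forall x : T -> R, \sum_a c a * \prod_i x i ^+ a i = 0) ->
  forall a, c a = 0.
Proof.
move=> c0 a0; pose N (a : {ffun T -> 'I_k}) := (\sum_i a i * k ^ enum_rank i)%N.
have NE a : N a = (\sum_(j < #|T|) a (enum_val j) * k ^ j)%N.
  rewrite /N (reindex (fun j : 'I_#|T| => enum_val j)) /=; last exact/onW_bij/enum_val_bij.
  by apply: eq_bigr => j _; rewrite enum_valK.
have N_inj : injective N.
  move=> a b; rewrite !NE => /digits_inj ab; apply/ffunP => i.
  by apply: val_inj; have := ab (fun=> ltn_ord _) (fun=> ltn_ord _) (enum_rank i);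
    rewrite /= enum_rankK.
have : \sum_a (c a)%:P * 'X^(N a) = 0 :> {poly R}.
  apply: poly_fun_eq0 => t; rewrite horner_sum -[RHS](c0 (fun i => t ^+ (k ^ enum_rank i)%N)).
  apply: eq_bigr => a _; rewrite hornerM hornerC hornerXn /N expr_sum.
  by congr (_ * _); apply: eq_bigr => i _; rewrite -exprM mulnC.
move=> /(congr1 (fun P : {poly R} => P`_(N a0))); rewrite coef0 coef_sum.
rewrite (bigD1 a0)//= coefCM coefXn eqxx mulr1 big1 ?addr0// => a aa0.
by rewrite coefCM coefXn (inj_eq N_inj) eq_sym (negbTE aa0) mulr0.
Qed.

(** Any [k > C.+1 ^ d] works, because [(C * k).+1 <= C.+1 * k]. Below, [k ^ a] counts monomials and
    [(C * k).+1 ^ d] grid points. *)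
Lemma exists_expn_gt (C a d : nat) : (d < a)%N ->
  exists k, ((C * k).+1 ^ d < k ^ a)%N.
Proof.
move=> da; exists (C.+1 ^ d).+1; set k := (C.+1 ^ d).+1.
apply: (@leq_ltn_trans ((C.+1 * k) ^ d)%N).
  by case: (posnP d) => [->//|d0]; rewrite leq_exp2r// mulSn -[leqLHS]add1n leq_add2r.
rewrite expnMn; apply: (@leq_trans (k ^ d.+1)); last by rewrite leq_exp2l// ltnS expn_gt0.
by rewrite expnS ltn_pmul2r ?expn_gt0.
Qed.

(* If [|Q| < |I|], the monomials of degree [< k] in the coordinates [I],
   pulled back to the parameter space, are more numerous than the points of a
   grid on which a polynomial of their degree is determined. *)
Lemma coord_indep_image (m d : nat) (S : set 'rV[R]_m) (I : {set 'I_m})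
    (Q : {set 'I_d}) (f : 'I_m -> pexpr R d) :
  (forall i, pvars_in Q (f i)) ->
  S `<=` [set w | exists x, w = \row_i peval (f i) x] ->
  coord_indep S I -> (#|I| <= #|Q|)%N.
Proof.
move=> Qf Sf SI; rewrite leqNgt; apply/negP => QI.
pose e := \max_i pdeg (f i).
have fe i : (pdeg (f i) <= e)%N by exact: (leq_bigmax i).
have [k kK] := exists_expn_gt (#|I| * e) QI.
(* [#|I| * e * k] bounds the degree of the pulled-back combinations of monomials, so [K] grid values
   per parameter determine them. *)
set K := (#|I| * e * k).+1 in kK.
pose TI := {i | i \in I}; pose TQ := {i | i \in Q}.
have cTI : #|{: TI}| = #|I| by rewrite card_sig.
have cTQ : #|{: TQ}| = #|Q| by rewrite card_sig.
pose A := {ffun TI -> 'I_k}; pose G := {ffun TQ -> 'I_K}.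
have cA : #|{: A}| = (k ^ #|I|)%N by rewrite card_ffun card_ord cTI.
have cG : #|{: G}| = (K ^ #|Q|)%N by rewrite card_ffun card_ord cTQ.
pose mono (a : A) : pexpr R m := pprod (fun i : TI => ppow (PVar (val i)) (a i)).
pose pt (g : G) : 'rV[R]_d :=
  \row_i (if insub i is Some j then (g j)%:R else 0).
pose M : 'M[R]_(#|{: A}|, #|{: G}|) :=
  \matrix_(a, g) peval (psubst f (mono (enum_val a))) (pt (enum_val g)).
(* There are more rows (monomials) than columns (grid points), so a nontrivial combination of
   monomials vanishes on the whole grid after pull-back. *)
have kerM : kermx M != 0.
  rewrite kermx_eq0 /row_free neq_ltn (leq_ltn_trans (rank_leq_col M))//.
  by rewrite cA cG.
have [r cM] : exists r, row r (kermx M) != 0.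
  apply: contrapT => /forallNP r0; move/negP: kerM; apply; apply/eqP/row_matrixP => r.
  by rewrite row0; apply/eqP; apply: contraT => /(r0 r).
pose c := row r (kermx M).
have cM0 : c *m M = 0 by rewrite -row_mul mulmx_ker row0.
pose p := psum (fun a : A => PMul (PConst (c 0 (enum_rank a))) (mono a)).
have pe x : peval p x = \sum_(a : A) c 0 (enum_rank a) * \prod_i x 0 (val i) ^+ a i.
  rewrite peval_psum; apply: eq_bigr => a _ /=; rewrite peval_pprod.
  by under eq_bigr do rewrite peval_ppow.
have Ip : pvars_in I p.
  apply: pvars_in_psum => a /=; apply: pvars_in_pprod => i.
  by apply: pvars_in_ppow; exact: valP.
have pf0 x : peval (psubst f p) x = 0.
  have Qp : pvars_in Q (psubst f p) by exact: pvars_in_psubst.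
  apply: (@peval_grid_eq0 _ _ _ K).
    apply: leq_ltn_trans (pdeg_psubst p fe) _; rewrite ltnS /K mulnAC.
    rewrite leq_mul2r; apply/orP; right; apply: pdeg_psum => a /=.
    rewrite -cTI; apply: pdeg_pprod => i.
    by apply: leq_trans (pdeg_ppow _ _) _; rewrite muln1 ltnW.
  move=> g gK; pose g' : G := [ffun i => Ordinal (gK (val i))].
  rewrite (@peval_eq_on _ _ _ _ _ (pt g') Qp); last first.
    by move=> i Qi; rewrite !mxE insubT ffunE.
  have := congr1 (fun N : 'rV__ => N 0 (enum_rank g')) cM0; rewrite !mxE => <-.
  rewrite peval_psubst pe (reindex (fun j : 'I_#|{: A}| => enum_val j)) /=; last exact/onW_bij/enum_val_bij.
  apply: eq_bigr => a _; rewrite !mxE enum_rankK enum_valK; congr (_ * _).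
  rewrite peval_psubst peval_pprod; apply: eq_bigr => i _.
  by rewrite peval_ppow.
have p0 : forall x, peval p x = 0.
  by apply: SI => // w /Sf[x ->]; rewrite -peval_psubst.
have c0 : forall a : A, c 0 (enum_rank a) = 0.
  apply: monomials_indep => x.
  rewrite -[RHS](p0 (\row_i if insub i is Some j then x j else 0)) pe.
  apply: eq_bigr => a _; congr (_ * _); apply: eq_bigr => i _.
  by rewrite mxE valK.
move/negP: cM; apply; apply/eqP/rowP => a; rewrite -[a]enum_valK.
by rewrite [LHS]c0 mxE.
Qed.

End Counting.

(** * Independence from tangent directions *)

(** Both sides set the two variables to 0, the left one after identifying them. *)
Lemma horner_horner0 (A : comNzRingType) (D : {poly {poly A}}) :
  (D.['X]).[0] = (D`_0).[0].
Proof.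
elim/poly_ind: D => [|D c _]; first by rewrite horner0 coef0.
by rewrite hornerMXaddC hornerD hornerMX mulr0 add0r coefD coefMX coefC eqxx add0r.
Qed.

(* If every direction [y] is, on the coordinates [I], the initial velocity of a
   curve in [S] starting at [a], then the coordinates [I] are independent on
   [S]: expanding a polynomial vanishing on [S] at [a] into homogeneous parts,
   the lowest nonzero part would have to vanish at every [y]. *)
Lemma coord_indep_tangent (R : realType) (m : nat) (S : set 'rV[R]_m)
    (I : {set 'I_m}) (a : 'rV[R]_m) :
  (forall y : 'rV[R]_m, exists g : 'I_m -> {poly R}, forall h, exists w,
    S w /\ forall i, i \in I -> w 0 i = a 0 i + h * (y 0 i + h * (g i).[h])) ->
  coord_indep S I.
Proof.
move=> curve q Iq Sq.
(* Coefficient [r] of [L y] is the homogeneous part of degree [r] of [q] expanded at [a], evaluated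
   at [y]. *)
pose L (y : 'rV[R]_m) : {poly R} :=
  peval (pmap polyC q) (\row_i ((a 0 i)%:P + (y 0 i)%:P * 'X)).
have L0 r y : (L y)`_r = 0.
  have [n] := ubnP r; elim: n r y => // n IHn r y /ltnSE rn.
  have [g gS] := curve y.
  pose z : 'rV[{poly R}]_m := \row_i ((y 0 i)%:P + 'X * g i).
  (* [G] separates the two roles of [h]: the outer variable scales the direction, the inner one
     bends it into [z = y + h g(h)]. The curve in [S] is the diagonal. *)
  pose G : {poly {poly R}} := peval (pmap polyC (pmap polyC q))
    (\row_i ((a 0 i)%:P%:P + (z 0 i)%:P * 'X)).
  have GX : G.['X] = 0.
    apply: poly_fun_eq0 => h; rewrite !horner_peval.
    have [w [Sw wI]] := gS h; rewrite -[RHS](Sq w Sw).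
    apply: (peval_eq_on Iq) => i iI; rewrite !mxE wI//.
    by rewrite !(hornerD, hornerM, hornerX, hornerC) mulrC.
  have GL s h : (G`_s).[h] = (L (\row_i (z 0 i).[h]))`_s.
    rewrite -[LHS]/(horner_eval h _) -coef_map /L; congr (_`_s).
    rewrite -peval_pmap !pmap_comp (@eq_pmap _ _ _ _ polyC); last first.
      by move=> c; rewrite /= map_polyC /= /horner_eval hornerC.
    suff -> : map_mx (map_poly (horner_eval h)) (\row_i ((a 0 i)%:P%:P + (z 0 i)%:P * 'X)) =
      \row_i ((a 0 i)%:P + ((\row_i (z 0 i).[h]) 0 i)%:P * 'X) by [].
    apply/rowP => i; rewrite !mxE rmorphD rmorphM /= !map_polyC map_polyX /=.
    by rewrite /horner_eval hornerC.
  (* The induction runs over all directions because the lower parts must vanish at the moving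
     direction [z], not only at [y]. *)
  have Gs s : (s < r)%N -> G`_s = 0.
    by move=> sr; apply: poly_fun_eq0 => h; rewrite GL IHn// (leq_trans sr).
  pose D := drop_poly r G; have GE : G = D * 'X^r.
    rewrite -[LHS](poly_take_drop r) [take_poly _ _](_ : _ = 0) ?add0r//.
    by apply/polyP => s; rewrite coef_take_poly coef0; case: ifP => // /Gs.
  have DX : D.['X] = 0.
    move/eqP: GX; rewrite GE hornerM hornerXn mulf_eq0 => /orP[/eqP//|].
    by rewrite expf_eq0 polyX_eq0 andbF.
  (* With the factor [h ^ r] divided out of the diagonal identity, setting [h = 0] leaves the part
     of degree [r] at [y]. *)
  have := horner_horner0 D; rewrite DX horner0 coef_drop_poly GL.
  rewrite add0n => Lz; rewrite [RHS]Lz; congr ((L _)`_r); apply/rowP => i; rewrite !mxE.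
  by rewrite hornerD hornerM hornerX hornerC mul0r addr0.
move=> x; have : (L (x - a)).[1] = 0.
  by rewrite (_ : L _ = 0) ?horner0//; apply/polyP => r; rewrite L0 coef0.
rewrite horner_peval => <-; congr peval; apply/rowP => i; rewrite !mxE.
rewrite hornerD hornerM hornerX !hornerC mulr1.
by rewrite [RHS]addrC subrK.
Qed.

(** * Projections of semialgebraic sets *)

Lemma semialgebraicT (R : realType) (m : nat) : semialgebraic [set: 'rV[R]_m].
Proof.
rewrite (_ : setT = [set x | peval (PConst 0) x = 0]); first exact: sa_zero.
by apply/seteqP; split.
Qed.

Lemma semialgebraic_forall (R : realType) (m : nat) (T : finType)
    (F : T -> set 'rV[R]_m) :
  (forall t, semialgebraic (F t)) -> semialgebraic [set x | forall t, F t x].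
Proof.
move=> saF; suff H (s : seq T) : semialgebraic [set x | forall t, t \in s -> F t x].
  rewrite (_ : mkset _ = [set x | forall t, t \in enum T -> F t x])//.
  by apply/seteqP; split => x Fx t //; apply: Fx; rewrite mem_enum.
elim: s => [|t s IHs].
  rewrite (_ : mkset _ = setT); first exact: semialgebraicT.
  by apply/seteqP; split.
rewrite (_ : mkset _ = F t `&` [set x | forall t, t \in s -> F t x]).
  exact: sa_inter.
apply/seteqP; split => x /=.
  by move=> Fx; split=> [|u us]; apply: Fx; rewrite inE ?eqxx// us orbT.
by move=> [Ft Fs] u; rewrite inE => /predU1P[->|/Fs].
Qed.

Lemma semialgebraic_exists (R : realType) (m : nat) (T : finType)
    (F : T -> set 'rV[R]_m) :
  (forall t, semialgebraic (F t)) -> semialgebraic [set x | exists t, F t x].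
Proof.
move=> saF; rewrite (_ : mkset _ = ~` [set x | forall t, (~` F t) x]).
  by apply: sa_compl; apply: semialgebraic_forall => t; exact: sa_compl.
by apply/seteqP; split => x /=; [move=> [t ?]; apply/existsNP; exists t; exact|
  move=> /existsNP[t /contrapT]; exists t].
Qed.

(** * Tarski-Seidenberg from quantifier elimination *)

Section TarskiSeidenberg.
Variable R : realType.

Definition env (m : nat) (x : 'rV[R]_m) : seq R := [seq x 0 i | i <- enum 'I_m].

Lemma size_env m (x : 'rV_m) : size (env x) = m.
Proof. by rewrite size_map size_enum_ord. Qed.

Lemma nth_env m (x : 'rV_m) (i : 'I_m) : (env x)`_i = x 0 i.
Proof. by rewrite (nth_map i) ?size_enum_ord// nth_ord_enum. Qed.

Lemma env_row_mx m p (x : 'rV_m) (y : 'rV_p) :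
  env (row_mx x y) = env x ++ env y.
Proof.
apply: (@eq_from_nth _ 0); first by rewrite size_cat !size_env.
rewrite size_env => i ip; rewrite -[i]/(val (Ordinal ip)).
move: (Ordinal ip) => {ip}k; rewrite nth_env nth_cat size_env.
case: (split_ordP k) => j ->.
  by rewrite row_mxEl (nth_env x j).
by rewrite row_mxEr /= addKn nth_env.
Qed.

Lemma env_surj m (s : seq R) : size s = m -> exists x : 'rV_m, env x = s.
Proof.
move=> sm; exists (\row_i s`_i); apply: (@eq_from_nth _ 0); rewrite size_env// => i im.
by rewrite -[i]/(val (Ordinal im)) nth_env mxE.
Qed.

Section TermToPexpr.
Variable m : nat.

(** Inverses get a junk value, as the translation is correct only on ring terms. A variable beyond
    [m] becomes 0, the default of [nth] in [GRing.eval]. *)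
Fixpoint pexpr_of_term (t : GRing.term R) : pexpr R m :=
  match t with
  | GRing.Var k => if insub k is Some i then PVar i else PConst 0
  | GRing.Const c => PConst c
  | GRing.NatConst k => PConst k%:R
  | GRing.Add u v => PAdd (pexpr_of_term u) (pexpr_of_term v)
  | GRing.Opp u => POpp (pexpr_of_term u)
  | GRing.NatMul u k => PMul (PConst k%:R) (pexpr_of_term u)
  | GRing.Mul u v => PMul (pexpr_of_term u) (pexpr_of_term v)
  | GRing.Inv _ => PConst 0
  | GRing.Exp u k => ppow (pexpr_of_term u) k
  end.

Lemma peval_pexpr_of_term t x : GRing.rterm t ->
  peval (pexpr_of_term t) x = GRing.eval (env x) t.
Proof.
elim: t => //= [k _|u IHu v IHv /andP[/IHu -> /IHv ->]|u IHu /IHu ->|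
  u IHu k /IHu ->|u IHu v IHv /andP[/IHu -> /IHv ->]|u IHu k /IHu uE]//.
- case: insubP => [i _ <-|]; first by rewrite nth_env.
  by rewrite -leqNgt => mk; rewrite nth_default ?size_env.
- by rewrite mulr_natl.
- by rewrite peval_ppow uE.
Qed.

Import ordered_qelim.ord.

Lemma semialgebraic_qf (f : formula R) : qf_form f -> rformula f ->
  semialgebraic [set x : 'rV[R]_m | qf_eval (env x) f].
Proof.
have sa_lt t u : GRing.rterm t -> GRing.rterm u ->
    semialgebraic [set x : 'rV[R]_m | GRing.eval (env x) t < GRing.eval (env x) u].
  move=> rt ru; rewrite (_ : mkset _ = [set x | 0 < peval
      (PAdd (pexpr_of_term u) (POpp (pexpr_of_term t))) x]); first exact: sa_pos.
  by apply/seteqP; split => x /=; rewrite !peval_pexpr_of_term// subr_gt0.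
elim: f => //=.
- move=> [] _ _.
    rewrite (_ : mkset _ = setT); first exact: semialgebraicT.
    by apply/seteqP; split.
  rewrite (_ : mkset _ = ~` setT); first by apply: sa_compl; exact: semialgebraicT.
  by apply/seteqP; split => x //= /(_ I).
- move=> t u _ /andP[rt ru]; rewrite (_ : mkset _ = [set x | peval
      (PAdd (pexpr_of_term u) (POpp (pexpr_of_term t))) x = 0]); first exact: sa_zero.
  apply/seteqP; split => x /=; rewrite !peval_pexpr_of_term//.
    by move=> /eqP ->; rewrite subrr.
  by move=> /eqP; rewrite subr_eq0 eq_sym.
- by move=> t u _ /andP[rt ru]; exact: sa_lt.
- move=> t u _ /andP[rt ru]; rewrite (_ : mkset _ =
    ~` [set x | GRing.eval (env x) u < GRing.eval (env x) t]).
    by apply: sa_compl; exact: sa_lt.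
  by apply/seteqP; split => x /=; rewrite leNgt => /negP.
- move=> f IHf g IHg /andP[qf qg] /andP[rf rg].
  rewrite (_ : mkset _ = [set x | qf_eval (env x) f] `&` [set x | qf_eval (env x) g]).
    by apply: sa_inter; [exact: IHf|exact: IHg].
  by apply/seteqP; split => x /= /andP.
- move=> f IHf g IHg /andP[qf qg] /andP[rf rg].
  rewrite (_ : mkset _ = [set x | qf_eval (env x) f] `|` [set x | qf_eval (env x) g]).
    by apply: sa_union; [exact: IHf|exact: IHg].
  by apply/seteqP; split => x /= /orP.
- move=> f IHf g IHg /andP[qf qg] /andP[rf rg].
  rewrite (_ : mkset _ = ~` [set x | qf_eval (env x) f] `|` [set x | qf_eval (env x) g]).
    by apply: sa_union; [apply: sa_compl; exact: IHf|exact: IHg].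
  apply/seteqP; split => x /=; rewrite implybE.
    by move=> /orP[/negP|]; [left|right].
  by move=> [/negP ->//|->]; rewrite orbT.
- move=> f IHf qf rf; rewrite (_ : mkset _ = ~` [set x | qf_eval (env x) f]).
    by apply: sa_compl; exact: IHf.
  by apply/seteqP; split => x /= /negP.
Qed.

Lemma semialgebraic_holds (f : formula R) :
  semialgebraic [set x : 'rV[R]_m | holds (env x) f].
Proof.
rewrite (_ : mkset _ = [set x : 'rV[R]_m | qe_rcf.rcf_sat (env x) f]).
  (* [rcf_sat] evaluates at [env x] one quantifier-free formula that does not depend on [x]. *)
  have /andP[qf rf] := quantifier_elim_wf (@qe_rcf.wf_QE_wproj R) (to_rform_rformula f).
  exact: semialgebraic_qf.
by apply/seteqP; split => x /= /qe_rcf.rcf_satP.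
Qed.

Fixpoint term_of_pexpr (p : pexpr R m) : GRing.term R :=
  match p with
  | PVar i => GRing.Var _ i
  | PConst c => GRing.Const c
  | PAdd p q => GRing.Add (term_of_pexpr p) (term_of_pexpr q)
  | PMul p q => GRing.Mul (term_of_pexpr p) (term_of_pexpr q)
  | POpp p => GRing.Opp (term_of_pexpr p)
  end.

Lemma eval_term_of_pexpr p x : GRing.eval (env x) (term_of_pexpr p) = peval p x.
Proof. by elim: p => //= [i|p -> q ->|p -> q ->|p ->]; rewrite ?nth_env. Qed.

Lemma semialgebraic_formula (S : set 'rV[R]_m) : semialgebraic S ->
  exists f : formula R, S = [set x | holds (env x) f].
Proof.
elim=> [p|p|A B _ [f ->] _ [g ->]|A B _ [f ->] _ [g ->]|A _ [f ->]].
- exists (Lt (GRing.Const 0) (term_of_pexpr p)).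
  by apply/seteqP; split => x /=; rewrite eval_term_of_pexpr.
- exists (Equal (term_of_pexpr p) (GRing.Const 0)).
  by apply/seteqP; split => x /=; rewrite eval_term_of_pexpr.
- by exists (Or f g).
- by exists (And f g).
- by exists (Not f).
Qed.

End TermToPexpr.

Import ordered_qelim.ord.

(** Quantifying over the variable just past the end of an environment appends a value: [set_nth] at
    index [size e] is [rcons]. *)
Lemma holds_exists_iota (m p : nat) (f : formula R) (e : seq R) : size e = m ->
  holds e (foldr Exists f (iota m p)) <->
  exists s, size s = p /\ holds (e ++ s) f.
Proof.
elim: p m e => [|p IHp] m e em /=.
  by split=> [fe|[s [/size0nil ->]]]; [exists [::]|]; rewrite cats0.
have set_rcons x : set_nth 0 e m x = rcons e x.
  by rewrite -em; elim: e {em} => //= ? ? ->.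
split=> [[x]|]; last first.
  move=> [[|x s] []]// [sp] fs.
  exists x; rewrite set_rcons; apply/IHp; first by rewrite size_rcons em.
  by exists s; rewrite cat_rcons.
rewrite set_rcons => /IHp[|s [sp fs]]; first by rewrite size_rcons em.
by exists (x :: s); rewrite /= sp -cat_rcons.
Qed.

Lemma tarski_seidenberg (m p : nat) (S : set 'rV[R]_(m + p)) : semialgebraic S ->
  semialgebraic [set x : 'rV[R]_m | exists y : 'rV[R]_p, S (row_mx x y)].
Proof.
move=> /semialgebraic_formula[f ->].
rewrite (_ : mkset _ = [set x | holds (env x) (foldr Exists f (iota m p))]).
  exact: semialgebraic_holds.
apply/seteqP; split => x /=.
  move=> [y]; rewrite env_row_mx => fy; apply/holds_exists_iota.
    exact: size_env.
  by exists (env y); rewrite size_env.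
move=> /holds_exists_iota[|s [sp fs]]; first exact: size_env.
by have [y ys] := env_surj sp; exists y; rewrite env_row_mx ys.
Qed.

End TarskiSeidenberg.

(** * The defining equation of Y *)

Definition Midx (n : nat) : finType := (('I_n + 'I_n * 'I_n) + 'I_n * 'I_n * 'I_n)%type.

(** The left summand indexes [v3] and the right one [(v1, v2, lam)], so that the two nonvanishing
    conditions concern [inl] and [inr]. *)
Definition Pidx (n : nat) : finType := ('I_n + ('I_n + 'I_n + unit))%type.

Section Monomials.
Variable n : nat.
Implicit Types (k : Midx n) (j : 'I_n).

(* The length of the list tells the coefficients of [L], [B] and [T] apart. *)
Definition key k : seq nat :=
  match k with
  | inl (inl a) => [:: val a]
  | inl (inr (a, b)) => [:: val a; val b]
  | inr (a, b, c) => [:: val a; val b; val c]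
  end.

Definition sym_eq k k' := perm_eq (key k) (key k').

(** A representative of the class of [k] under permutation of its indices. Equivalent arguments give
    [pick] the same predicate, hence the same choice. *)
Definition srt k : Midx n := odflt k [pick k' | sym_eq k' k].

Lemma srtP k : sym_eq (srt k) k.
Proof. by rewrite /srt; case: pickP => //= _; exact: perm_refl. Qed.

Lemma srt_eq k k' : (srt k == srt k') = sym_eq k k'.
Proof.
apply/eqP/idP => [kk'|kk'].
  have := srtP k; rewrite kk' /sym_eq perm_sym => /perm_trans; apply; exact: srtP.
rewrite /srt (eq_pick (Q := fun k'' => sym_eq k'' k')); last first.
  by move=> k''; apply: permPr.
by case: pickP => //= /(_ k'); rewrite /sym_eq perm_refl.
Qed.

Lemma srt_id k : srt (srt k) = srt k.
Proof. by apply/eqP; rewrite srt_eq srtP. Qed.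

Definition ix_v j : Pidx n := inl j.
Definition ix_v1 j : Pidx n := inr (inl (inl j)).
Definition ix_v2 j : Pidx n := inr (inl (inr j)).
Definition ix_lam : Pidx n := inr (inr tt).

(* [cf X k] is the factor of the coordinate [(i, k)] of [w] in the [i]-th
   component of [L(v1) + B(v2, v) + lam T(v, v, v)]. *)
Definition cf (A : pzRingType) (X : Pidx n -> A) k : A :=
  match k with
  | inl (inl a) => X (ix_v1 a)
  | inl (inr (a, b)) => X (ix_v2 a) * X (ix_v b)
  | inr (a, b, c) => X ix_lam * X (ix_v a) * X (ix_v b) * X (ix_v c)
  end.

Lemma eq_cf (A : pzRingType) (X Y : Pidx n -> A) : X =1 Y -> cf X =1 cf Y.
Proof. by move=> XY [[a|[a b]]|[[a b] c]] /=; rewrite !XY. Qed.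

Definition cfp (A : Type) (d : nat) (X : Pidx n -> pexpr A d) k : pexpr A d :=
  match k with
  | inl (inl a) => X (ix_v1 a)
  | inl (inr (a, b)) => PMul (X (ix_v2 a)) (X (ix_v b))
  | inr (a, b, c) =>
      PMul (PMul (PMul (X ix_lam) (X (ix_v a))) (X (ix_v b))) (X (ix_v c))
  end.

Lemma peval_cfp (A : pzRingType) d (X : Pidx n -> pexpr A d) k x :
  peval (cfp X k) x = cf (fun p => peval (X p) x) k.
Proof. by case: k => [[a|[a b]]|[[a b] c]]. Qed.

Lemma pvars_in_cfp (A : Type) d (Q : {set 'I_d}) (X : Pidx n -> pexpr A d) k :
  (forall p, pvars_in Q (X p)) -> pvars_in Q (cfp X k).
Proof. by move=> QX; case: k => [[a|[a b]]|[[a b] c]] /=; rewrite ?QX. Qed.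

End Monomials.

Lemma perm_eq2 (T : eqType) (a b c d : T) : perm_eq [:: a; b] [:: c; d] ->
  (a = c /\ b = d) \/ (a = d /\ b = c).
Proof.
move=> abcd; have := perm_mem abcd a; rewrite !inE eqxx /= => /esym/orP[]/eqP ac.
  move: abcd; rewrite ac perm_cons => /perm_mem/(_ b).
  by rewrite !inE eqxx => /esym/eqP ->; left.
move: abcd; rewrite ac -[[:: c; d]]/([:: c] ++ [:: d]) perm_sym perm_catC perm_cons.
by move=> /perm_mem/(_ b); rewrite !inE eqxx => /eqP ->; right.
Qed.

Section Equation.
Variables (R : realType) (n N : nat).
Implicit Types (w : 'rV[R]_(Wdim n N)) (i : 'I_N) (k : Midx n).

Lemma Wset_srt w :
  Wset w <-> forall i k, wcoord w (i, k) = wcoord w (i, srt k).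
Proof.
split=> [[symB [symT1 symT2]] i k|sym].
  have := srtP k; move: (srt k) => k'.
  case: k k' => [[a|[a b]]|[[a b] c]] [[a'|[a' b']]|[[a' b'] c']];
    rewrite /sym_eq /= => kk'; have := perm_size kk' => //= _.
  - by have := perm_mem kk' a; rewrite !inE eqxx => /eqP/val_inj ->.
  - by case: (perm_eq2 kk') => -[/val_inj -> /val_inj ->].
  (* Transpositions bring the entry equal to [a'] to the front, which leaves a permutation of two
     entries. *)
  have : val a' \in [:: val a; val b; val c].
    by rewrite -(perm_mem kk') inE eqxx.
  rewrite !inE => /or3P[] /eqP/val_inj a'E.
  - move: kk'; rewrite a'E perm_cons => /perm_eq2[] [/val_inj -> /val_inj ->]//.
  - rewrite symT1; have : perm_eq [:: val a'; val b'; val c'] [:: val b; val a; val c].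
      by apply: perm_trans kk' _; apply/permP => p /=; rewrite addnCA.
    by rewrite a'E perm_cons => /perm_eq2[] [/val_inj -> /val_inj ->].
  - rewrite symT2 symT1.
    have : perm_eq [:: val a'; val b'; val c'] [:: val c; val a; val b].
      by apply: perm_trans kk' _; apply/permP => p /=; rewrite !addn0 addnA addnC.
    by rewrite a'E perm_cons => /perm_eq2[] [/val_inj -> /val_inj ->].
have symk i k k' : sym_eq k k' -> wcoord w (i, k) = wcoord w (i, k').
  by rewrite -srt_eq => /eqP kk'; rewrite sym kk' -sym.
split=> [i a b|]; first by apply: symk; apply/permP => p /=; rewrite addnCA.
split=> i a b c; apply: symk; apply/permP => p /=; first by rewrite addnCA.
by congr (_ + _)%N; rewrite addnCA.
Qed.

Lemma equationE w (v v1 v2 : 'rV[R]_n) (lam : R) (X : Pidx n -> R) i :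
  (forall j, X (ix_v j) = v 0 j) -> (forall j, X (ix_v1 j) = v1 0 j) ->
  (forall j, X (ix_v2 j) = v2 0 j) -> X (ix_lam n) = lam ->
  (Lmap w v1 + Bmap w v2 v + lam *: Tmap w v v v) 0 i =
  \sum_k wcoord w (i, k) * cf X k.
Proof.
move=> Xv Xv1 Xv2 Xlam; rewrite !mxE big_sumType big_sumType /=.
congr (_ + _ + _).
- by apply: eq_bigr => j _; rewrite Xv1.
- rewrite pair_big; apply: eq_bigr => -[a b] _ /=.
  by rewrite Xv2 Xv mulrA.
- rewrite pair_big /= pair_big /= mulr_sumr.
  apply: eq_bigr => -[[a b] c] _ /=; rewrite Xlam !Xv !mulrA.
  by rewrite [lam * _]mulrC.
Qed.

Definition solves w (X : Pidx n -> R) :=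
  forall i, \sum_k wcoord w (i, k) * cf X k = 0.

Lemma YsetE w : Yset w <-> Wset w /\ exists X : Pidx n -> R,
  [/\ exists j, X (inl j) != 0, exists u, X (inr u) != 0 & solves w X].
Proof.
split=> [[Ww [v [v1 [v2 [lam [v0 [u0 eq0]]]]]]]|[Ww [X [[j Xj] [u Xu] eq0]]]];
  split=> //.
  pose X (p : Pidx n) := match p with
    | inl j => v 0 j
    | inr (inl (inl j)) => v1 0 j
    | inr (inl (inr j)) => v2 0 j
    | inr (inr _) => lam
    end.
  exists X; split.
  - by have /rV0Pn[j vj] := v0; exists j.
  - apply: contrapT => /forallNP X0; apply: u0; split; [|split].
    + apply/rowP => j; rewrite mxE; apply/eqP; apply: contraT => v1j.
      by case: (X0 (inl (inl j))).
    + apply/rowP => j; rewrite mxE; apply/eqP; apply: contraT => v2j.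
      by case: (X0 (inl (inr j))).
    + by apply/eqP; apply: contraT => l0; case: (X0 (inr tt)).
  - move=> i; rewrite -(equationE w (v := v) (v1 := v1) (v2 := v2) (lam := lam))//.
    by rewrite eq0 mxE.
exists (\row_j X (ix_v j)), (\row_j X (ix_v1 j)), (\row_j X (ix_v2 j)), (X (ix_lam n)).
split; first by apply/rV0Pn; exists j; rewrite mxE.
split.
  move=> [v10 [v20 l0]]; move: Xu; case: u => [[a|a]|[]].
  - by have := congr1 (fun M : 'rV_n => M 0 a) v10; rewrite !mxE => ->; rewrite eqxx.
  - by have := congr1 (fun M : 'rV_n => M 0 a) v20; rewrite !mxE => ->; rewrite eqxx.
  - by rewrite l0 eqxx.
by apply/rowP => i; rewrite (equationE w (X := X)) ?eq0 ?mxE// => l; rewrite mxE.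
Qed.

End Equation.

(** * Y is semialgebraic and closed *)

Section EquationPexpr.
Variables (R : realType) (n N : nat).

Definition eqp (i : 'I_N) : pexpr R (Wdim n N + #|Pidx n|) :=
  psum (fun k : Midx n => PMul (PVar (lshift _ (enum_rank ((i, k) : Widx n N))))
    (cfp (fun p => PVar (rshift _ (enum_rank p))) k)).

Lemma peval_eqp i (w : 'rV[R]_(Wdim n N)) (x : 'rV[R]_#|Pidx n|) :
  peval (eqp i) (row_mx w x) =
  \sum_k wcoord w (i, k) * cf (fun p => x 0 (enum_rank p)) k.
Proof.
rewrite peval_psum; apply: eq_bigr => k _ /=; rewrite row_mxEl peval_cfp.
by congr (_ * _); apply: eq_cf => p /=; rewrite row_mxEr.
Qed.

Lemma solves_eqp w (x : 'rV[R]_#|Pidx n|) :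
  solves w (fun p => x 0 (enum_rank p)) <->
  forall i, peval (eqp i) (row_mx w x) = 0.
Proof. by split=> H i; move: (H i); rewrite peval_eqp. Qed.

Lemma solves_row (w : 'rV[R]_(Wdim n N)) (X : Pidx n -> R) : solves w X ->
  exists x : 'rV_#|Pidx n|, (fun p => x 0 (enum_rank p)) = X /\
    forall i, peval (eqp i) (row_mx w x) = 0.
Proof.
move=> wX; exists (\row_a X (enum_val a)).
have XE : (fun p => (\row_a X (enum_val a)) 0 (enum_rank p)) = X.
  by apply/funext => p; rewrite mxE enum_rankK.
by split=> //; apply/solves_eqp; rewrite XE.
Qed.

Definition Wdiff (k : Widx n N) : pexpr R (Wdim n N) :=
  PAdd (PVar (enum_rank k)) (POpp (PVar (enum_rank ((k.1, srt k.2) : Widx n N)))).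

Lemma Wset_Wdiff : @Wset R n N = [set w | forall k, peval (Wdiff k) w = 0].
Proof.
apply/seteqP; split => w.
  by move=> /Wset_srt sym [i k] /=; apply/eqP; rewrite subr_eq0; apply/eqP/sym.
move=> sym; apply/Wset_srt => i k; apply/eqP; rewrite -subr_eq0; apply/eqP.
exact: (sym (i, k)).
Qed.

Lemma semialgebraic_Yset : semialgebraic (@Yset R n N).
Proof.
pose S : set 'rV[R]_(Wdim n N + #|Pidx n|) :=
  [set z | exists j, peval (PVar (rshift _ (enum_rank (inl j : Pidx n)))) z <> 0] `&`
  ([set z | exists u, peval (PVar (rshift _ (enum_rank (inr u : Pidx n)))) z <> 0] `&`
   [set z | forall i, peval (eqp i) z = 0]).
have -> : @Yset R n N = @Wset R n N `&`
    [set w | exists x : 'rV_#|Pidx n|, S (row_mx w x)].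
  apply/seteqP; split => w.
    move=> /YsetE[Ww [X [[j Xj] [u Xu] /solves_row[x [XE eq0]]]]]; split=> //.
    exists x; split; [|split] => //=.
      by exists j; move/eqP: Xj; rewrite -XE /= row_mxEr.
    by exists u; move/eqP: Xu; rewrite -XE /= row_mxEr.
  move=> [Ww [x [[j xj] [[u xu] eq0]]]]; apply/YsetE; split=> //.
  exists (fun p => x 0 (enum_rank p)); split; last exact/solves_eqp.
    by exists j; apply/eqP; move: xj => /=; rewrite row_mxEr.
  by exists u; apply/eqP; move: xu => /=; rewrite row_mxEr.
apply: sa_inter.
  by rewrite Wset_Wdiff; apply: semialgebraic_forall => k; exact: sa_zero.
apply: tarski_seidenberg; apply: sa_inter; [|apply: sa_inter].
- by apply: semialgebraic_exists => j; apply: sa_compl; exact: sa_zero.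
- by apply: semialgebraic_exists => u; apply: sa_compl; exact: sa_zero.
- by apply: semialgebraic_forall => i; exact: sa_zero.
Qed.

End EquationPexpr.

(** * Continuity of polynomials and closedness by compactness *)

Lemma cvg_peval (R : realType) (m : nat) (T : Type) (F : set_system T)
    {FF : Filter F} (f : T -> 'rV[R]_m) (a : 'rV[R]_m) (p : pexpr R m) :
  (forall i, f t 0 i @[t --> F] --> a 0 i) ->
  peval p (f t) @[t --> F] --> peval p a.
Proof.
move=> fa; elim: p => //= [c|p IHp q IHq|p IHp q IHq|p IHp].
- exact: cvg_cst.
- exact: cvgD.
- exact: cvgM.
- exact: cvgN.
Qed.

Lemma closed_peval_eq0 (R : realType) (m : nat) (p : pexpr R m) :
  closed [set x | peval p x = 0].
Proof.
apply: (@preimage_closed _ _ (peval p) [set y | y = 0]); last exact: closed_eq.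
move=> x _; apply: (@cvg_peval _ _ _ _ (nbhs_filter x)) => i.
exact: coord_continuous.
Qed.

(** Tube lemma: if no [x] in [K] solves the system at [w], near each [(x, w)] some polynomial stays
    nonzero, and compactness of [K] makes the neighbourhood of [w] uniform in [x]. *)
Lemma closed_exists_compact (R : realType) (m d : nat) (T : finType)
    (K : set 'rV[R]_d) (p : T -> pexpr R (m + d)) : compact K ->
  closed [set w : 'rV[R]_m | exists x, K x /\
    forall t, peval (p t) (row_mx w x) = 0].
Proof.
move=> /compact_near_coveringP cK; rewrite -openC openE => w /= nw.
have : \forall w' \near w, K `<=` [set x | exists t, peval (p t) (row_mx w' x) != 0].
  apply: (cK _ (nbhs w) (fun w' x => exists t, peval (p t) (row_mx w' x) != 0)).
  move=> x Kx; have [t pt] : exists t, peval (p t) (row_mx w x) != 0.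
    apply: contrapT => /forallNP pt0; apply: nw; exists x; split=> // t.
    by apply/eqP; apply: contraT => /(pt0 t).
  have : peval (p t) (row_mx z.2 z.1) @[z --> (x, w)] --> peval (p t) (row_mx w x).
    apply: cvg_peval => i; case: (split_ordP i) => j ->.
      rewrite row_mxEl; under eq_fun do rewrite row_mxEl.
      apply: (@cvg_comp _ _ _ snd (fun w' : 'rV[R]_m => w' 0 j)); first exact: cvg_snd.
      exact: coord_continuous.
    rewrite row_mxEr; under eq_fun do rewrite row_mxEr.
    apply: (@cvg_comp _ _ _ fst (fun x' : 'rV[R]_d => x' 0 j)); first exact: cvg_fst.
    exact: coord_continuous.
  move=> /cvgr_neq0 /(_ pt); apply: filterS => z pz; by exists t.
apply: filterS => w' Kw' [x [Kx px]]; have [t] := Kw' x Kx.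
by rewrite px eqxx.
Qed.

Section ClosedY.
Variables (R : realType) (n N : nat).

Lemma normalize_max (T : finType) (X : T -> R) t : X t != 0 ->
  exists2 t0, X t0 != 0 & forall t', `|X t' / X t0| <= 1.
Proof.
move=> Xt; case: (@Order.TotalTheory.arg_maxP _ _ T t predT (fun t => `|X t|)) => // t0 _ t0max.
have Xt0 : X t0 != 0 by rewrite -normr_gt0 (lt_le_trans _ (t0max t _))// normr_gt0.
exists t0 => // t'; rewrite normrM normfV ler_pdivrMr ?normr_gt0// mul1r.
exact: t0max.
Qed.

(* The equation is invariant under
   [(v, v1, v2, lam) -> (v / s, v1, s v2, s ^ 3 lam)]. *)
Lemma solves_rescale_v (w : 'rV[R]_(Wdim n N)) (X : Pidx n -> R) j :
  X (inl j) != 0 -> solves w X ->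
  exists Y : Pidx n -> R, [/\ forall a, Y (inl a) = X (inl a) / X (inl j),
    forall p, (Y p == 0) = (X p == 0) & solves w Y].
Proof.
move=> Xj wX; set s := X (inl j) in Xj *.
pose Y (p : Pidx n) := match p with
  | inl a => X (inl a) / s
  | inr (inl (inl a)) => X (inr (inl (inl a)))
  | inr (inl (inr a)) => X (inr (inl (inr a))) * s
  | inr (inr a) => X (inr (inr a)) * s ^+ 3
  end.
exists Y; split=> //.
  move=> [a|[[a|a]|a]] //=; rewrite mulf_eq0 ?invr_eq0 ?expf_eq0 (negbTE Xj) ?orbF//.
move=> i; rewrite -[RHS](wX i); apply: eq_bigr => k _; congr (_ * _).
by case: k => [[a|[a b]]|[[a b] c]] //=; field.
Qed.

(** The equation is linear in [(v1, v2, lam)]. *)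
Lemma solves_rescale_u (w : 'rV[R]_(Wdim n N)) (X : Pidx n -> R) u :
  X (inr u) != 0 -> solves w X ->
  exists Z : Pidx n -> R, [/\ forall a, Z (inl a) = X (inl a),
    forall a, Z (inr a) = X (inr a) / X (inr u) & solves w Z].
Proof.
move=> Xu wX; set t := X (inr u) in Xu *.
pose Z (p : Pidx n) := match p with
  | inl a => X (inl a)
  | inr a => X (inr a) / t
  end.
exists Z; split=> // i.
transitivity ((\sum_k wcoord w (i, k) * cf X k) / t); last by rewrite wX mul0r.
rewrite mulr_suml; apply: eq_bigr => k _; rewrite -mulrA; congr (_ * _).
by case: k => [[a|[a b]]|[[a b] c]]; rewrite /cf /ix_v1 /ix_v2 /ix_v /ix_lam /Z //; field.
Qed.

(** Each block is divided by its entry of largest absolute value. The block of [v3] comes first,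
    since its rescaling also changes [v2] and [lam], whereas the second rescaling leaves [v3]
    alone. *)
Lemma solves_normalized (w : 'rV[R]_(Wdim n N)) (X : Pidx n -> R) :
  (exists j, X (inl j) != 0) -> (exists u, X (inr u) != 0) -> solves w X ->
  exists Z : Pidx n -> R, [/\ forall p, `|Z p| <= 1,
    exists j, Z (inl j) = 1, exists u, Z (inr u) = 1 & solves w Z].
Proof.
move=> [j0 Xj0] [u0 Xu0] wX.
have [j Xj jmax] := normalize_max (X := fun j => X (inl j)) Xj0.
have [Y [Yv Y0 wY]] := solves_rescale_v Xj wX.
have Yu0 : Y (inr u0) != 0 by rewrite Y0.
have [u Yu umax] := normalize_max (X := fun u => Y (inr u)) Yu0.
have [Z [Zv Zu wZ]] := solves_rescale_u Yu wY.
exists Z; split=> //.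
- by case=> a; rewrite ?Zv ?Yv ?Zu.
- by exists j; rewrite Zv Yv divff.
- by exists u; rewrite Zu divff.
Qed.

Lemma closed_Yset : closed (@Yset R n N).
Proof.
(* That some coordinate of a block equals 1 is the vanishing of the product of all [x - 1]: a closed
   condition that keeps the block away from 0. *)
pose P (T : finType) (f : T -> Pidx n) : pexpr R #|Pidx n| :=
  pprod (fun t => PAdd (PVar (enum_rank (f t))) (PConst (-1))).
have P0 (T : finType) (f : T -> Pidx n) x :
    peval (P T f) x = 0 <-> exists t, x 0 (enum_rank (f t)) = 1.
  rewrite peval_pprod; split=> [/eqP/prodf_eq0[t _]|[t xt]].
    by rewrite /= subr_eq0 => /eqP; exists t.
  by rewrite (bigD1 t)//= xt subrr mul0r.
pose K : set 'rV[R]_#|Pidx n| :=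
  [set x : 'rV[R]_#|Pidx n| | forall a, `[(-1 : R), 1]%classic (x ord0 a)] `&`
  ([set x | peval (P _ inl) x = 0] `&` [set x | peval (P _ inr) x = 0]).
have cK : compact K.
  apply: compact_closedI; last by apply: closedI; exact: closed_peval_eq0.
  by apply: (@rV_compact _ _ (fun=> `[(-1 : R), 1]%classic)) => _; exact: segment_compact.
have -> : @Yset R n N = @Wset R n N `&` [set w | exists x, K x /\
    forall i, peval (@eqp R n N i) (row_mx w x) = 0].
  apply/seteqP; split => w.
    move=> /YsetE[Ww [X [Xj Xu wX]]]; split=> //.
    have [Z [Z1 [j Zj] [u Zu] /solves_row[x [xZ eq0]]]] := solves_normalized Xj Xu wX.
    exists x; split=> //; split; [|split].
    - by move=> a /=; rewrite in_itv /= -ler_norml -[a]enum_valK; move: (Z1 (enum_val a)); rewrite -xZ.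
    - by apply/P0; exists j; move: Zj; rewrite -xZ.
    - by apply/P0; exists u; move: Zu; rewrite -xZ.
  move=> [Ww [x [[_ [/P0[j xj] /P0[u xu]]] eq0]]]; apply/YsetE; split=> //.
  exists (fun p => x 0 (enum_rank p)); split; last exact/solves_eqp.
    by exists j; rewrite xj oner_neq0.
  by exists u; rewrite xu oner_neq0.
apply: closedI; last exact: closed_exists_compact.
rewrite Wset_Wdiff (_ : mkset _ = \bigcap_k [set w | peval (@Wdiff R n N k) w = 0]).
  by apply: closed_bigI => k _; exact: closed_peval_eq0.
by apply/seteqP; split => w Hw // k; [move=> _; exact: Hw|exact: Hw].
Qed.

End ClosedY.

(** * Upper bound for the dimension of Y *)

Lemma sa_dim_unique (R : realType) (m : nat) (S : set 'rV[R]_m) (d : nat) :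
  (exists2 I, coord_indep S I & (d <= #|I|)%N) ->
  (forall I, coord_indep S I -> (#|I| <= d)%N) -> sa_dim S = d.
Proof.
move=> [I SI dI] Sd; apply/eqP; rewrite eqn_leq; apply/andP; split.
  by apply/bigmax_leqP => J /asboolP /Sd.
by apply: leq_trans dI _; apply: leq_bigmax_cond; apply/asboolP.
Qed.

Section Dimension.
Variables (R : realType) (n N : nat).
Implicit Types (w : 'rV[R]_(Wdim n N)) (k : Midx n).

Definition rep (a : 'I_(Wdim n N)) : 'I_(Wdim n N) :=
  enum_rank (((enum_val a).1, srt (enum_val a).2) : Widx n N).

Definition Widx_sorted : {set 'I_(Wdim n N)} :=
  [set a | srt (enum_val a).2 == (enum_val a).2]%SET.

Definition rank_ik (i : 'I_N) k : 'I_(Wdim n N) := enum_rank ((i, k) : Widx n N).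

Lemma rank_ik_inj i k i' k' : rank_ik i k = rank_ik i' k' -> i = i' /\ k = k'.
Proof. by move=> /enum_rank_inj []. Qed.

Lemma rank_ik_surj a : exists i k, a = rank_ik i k.
Proof.
exists (enum_val a).1, (enum_val a).2; rewrite /rank_ik -[LHS]enum_valK.
by case: (enum_val a).
Qed.

Lemma rank_ik_sorted i k : (rank_ik i k \in Widx_sorted) = (srt k == k).
Proof. by rewrite inE enum_rankK. Qed.

Lemma rep_rank_ik i k : rep (rank_ik i k) = rank_ik i (srt k).
Proof. by rewrite /rep enum_rankK. Qed.

Lemma rep_sorted a : rep a \in Widx_sorted.
Proof. by rewrite rank_ik_sorted srt_id. Qed.

Lemma Wset_rep w : Wset w <-> forall a, w 0 a = w 0 (rep a).
Proof.
rewrite Wset_srt; split=> sym.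
  by move=> a; have [i [k ->]] := rank_ik_surj a; rewrite rep_rank_ik; exact: sym.
by move=> i k; rewrite /wcoord sym rep_rank_ik.
Qed.

(** [W] is the graph of a linear map over its sorted coordinates: they take arbitrary values and
    determine the rest. *)
Lemma sa_dim_Wset : sa_dim (@Wset R n N) = #|Widx_sorted|.
Proof.
apply: sa_dim_unique.
  exists Widx_sorted => // p Cp Wp x.
  rewrite -(Wp (\row_a x 0 (rep a))); last first.
    apply/Wset_rep => a; rewrite !mxE; have [i [k ->]] := rank_ik_surj a.
    by rewrite !rep_rank_ik srt_id.
  apply: (peval_eq_on Cp) => a; have [i [k ->]] := rank_ik_surj a.
  by rewrite rank_ik_sorted mxE rep_rank_ik => /eqP ->.
move=> I; apply: (@coord_indep_image _ _ _ _ _ _ (fun a => PVar (rep a))).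
  by move=> a /=; exact: rep_sorted.
by move=> w /Wset_rep sym; exists w; apply/rowP => a; rewrite mxE.
Qed.

(* On the chart, the [N] coordinates [(i, k0)] are polynomials in the other
   sorted coordinates and the parameters [Q]. *)
Lemma coord_indep_chart (d : nat) (c : Midx n -> pexpr R d) (Q : {set 'I_d})
    (k0 : Midx n) (S : set 'rV[R]_(Wdim n N)) (I : {set 'I_(Wdim n N)}) :
  (forall k, pvars_in Q (c k)) ->
  (forall w, S w -> Wset w /\ exists x : 'rV[R]_d,
     \sum_(k | sym_eq k k0) peval (c k) x = 1 /\
     forall i, \sum_k wcoord w (i, k) * peval (c k) x = 0) ->
  coord_indep S I -> (#|I| + N <= #|Widx_sorted| + #|Q|)%N.
Proof.
move=> Qc Sc SI.
pose S0 : {set 'I_(Wdim n N)} := ((fun i => rank_ik i (srt k0)) @: 'I_N)%SET.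
have S0C : (S0 \subset Widx_sorted).
  by apply/fintype.subsetP => _ /imsetP[i _ ->]; rewrite rank_ik_sorted srt_id.
have cS0 : #|S0| = N.
  by rewrite card_imset ?card_ord// => i i' /rank_ik_inj[].
pose P : {set 'I_(Wdim n N + d)} :=
  ((@lshift _ _ @: (Widx_sorted :\: S0)) :|: (@rshift _ _ @: Q))%SET.
pose c' k := psubst (fun a : 'I_d => PVar (rshift (Wdim n N) a)) (c k).
(* On [W] the coordinates in the class of [k0] agree and their factors sum to 1, so each is minus
   the rest of the [i]-th equation. *)
pose f (a : 'I_(Wdim n N)) : pexpr R (Wdim n N + d) :=
  if sym_eq (enum_val a).2 k0 then
    POpp (psum (fun k => if sym_eq k k0 then PConst 0 else
      PMul (PVar (lshift d (rank_ik (enum_val a).1 (srt k)))) (c' k)))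
  else PVar (lshift d (rep a)).
have cP : (#|P| <= (#|Widx_sorted| - N) + #|Q|)%N.
  rewrite (leq_trans (leq_card_setU _ _))// leq_add ?leq_imset_card//.
  by rewrite (leq_trans (leq_imset_card _ _))// cardsD (finset.setIidPr S0C) cS0.
have NC : (N <= #|Widx_sorted|)%N by rewrite -{1}cS0 subset_leq_card.
suff : (#|I| <= #|P|)%N by lia.
have lP i k : ~~ sym_eq k k0 -> lshift d (rank_ik i (srt k)) \in P.
  move=> kk0; rewrite inE; apply/orP; left; apply: imset_f.
  rewrite !inE enum_rankK /= srt_id eqxx andbT; apply: contra kk0.
  by move=> /imsetP[i' _ /rank_ik_inj[_ /eqP]]; rewrite srt_eq.
apply: (coord_indep_image (f := f)) SI.
  move=> a; rewrite /f; case: ifPn => ak0 /=; last exact: lP.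
  apply: pvars_in_psum => k; case: ifPn => //= kk0; rewrite lP//=.
  rewrite /c'; elim: (c k) (Qc k) => //= [b Qb|p IHp q IHq|p IHp q IHq].
  - by rewrite inE; apply/orP; right; exact: imset_f.
  - by move=> /andP[/IHp -> /IHq ->].
  - by move=> /andP[/IHp -> /IHq ->].
move=> w /Sc[Ww [x [c1 eq0]]]; exists (row_mx w x); apply/rowP => a.
have c'E k : peval (c' k) (row_mx w x) = peval (c k) x.
  rewrite peval_psubst; congr (peval _ _); apply/rowP => b.
  by rewrite mxE /= row_mxEr.
have [i [k ->]] := rank_ik_surj a; move/Wset_srt: Ww => sym.
rewrite mxE /f enum_rankK /=; case: ifPn => kk0; last first.
  by rewrite /= row_mxEl rep_rank_ik; exact: sym.
rewrite /= peval_psum; apply/eqP; rewrite -addr_eq0 -[X in _ == X](eq0 i).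
rewrite [X in _ == X](bigID (fun k => sym_eq k k0)) /=; apply/eqP; congr (_ + _).
  rewrite -[LHS]mulr1 -[in LHS]c1 mulr_sumr; apply: eq_bigr => k' k'k0.
  congr (_ * _); rewrite [RHS]sym -[LHS]/(wcoord w (i, k)) sym.
  by move: kk0 k'k0; rewrite -!srt_eq => /eqP -> /eqP ->.
rewrite [LHS](bigID (fun k => sym_eq k k0)) /= big1 ?add0r => [|k' ->//].
apply: eq_bigr => k' /negbTE ->; rewrite /= c'E row_mxEl.
by congr (_ * _); rewrite [RHS]sym.
Qed.

Lemma card_Pidx : #|Pidx n| = (3 * n + 1)%N.
Proof. by rewrite !card_sum !card_ord card_unit; lia. Qed.

Lemma exists_first_neq0 (X : 'I_n -> R) : (exists j, X j != 0) ->
  exists2 j, X j != 0 & forall j' : 'I_n, (j' < j)%N -> X j' = 0.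
Proof.
move=> [j0 Xj0]; case: (@arg_minnP _ j0 (fun j => X j != 0) (fun j => nat_of_ord j) Xj0).
move=> j Xj jmin; exists j => // j' j'j; apply/eqP.
by apply: contraT => /jmin; rewrite leqNgt j'j.
Qed.

Lemma sym_eq_pair (a b : 'I_n) k : sym_eq k (inl (inr (a, b))) =
  (k == inl (inr (a, b))) || (k == inl (inr (b, a))).
Proof.
apply/idP/orP; last first.
  by case=> /eqP ->; rewrite /sym_eq ?perm_refl//; apply/permP => p /=; rewrite addnCA.
case: k => [[a'|[a' b']]|[[a' b'] c']]; rewrite /sym_eq => kk0;
  have := perm_size kk0 => //= _.
by case: (perm_eq2 kk0) => -[/val_inj -> /val_inj ->]; [left|right].
Qed.

Lemma sym_eq_single (a : 'I_n) k : sym_eq k (inl (inl a)) = (k == inl (inl a)).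
Proof.
apply/idP/eqP => [|->]; last by rewrite /sym_eq.
case: k => [[a'|[a' b']]|[[a' b'] c']]; rewrite /sym_eq => kk0;
  have := perm_size kk0 => //= _.
by have := perm_mem kk0 a'; rewrite !inE eqxx => /esym/eqP/val_inj ->.
Qed.

Lemma sym_eq_triple (a : 'I_n) k : sym_eq k (inr (a, a, a)) = (k == inr (a, a, a)).
Proof.
apply/idP/eqP => [|->]; last by rewrite /sym_eq.
case: k => [[a'|[a' b']]|[[a' b'] c']]; rewrite /sym_eq => kk0;
  have := perm_size kk0 => //= _.
have E (d : 'I_n) : val d \in [:: val a'; val b'; val c'] -> d = a.
  by rewrite (perm_mem kk0) !inE !orbb => /eqP/val_inj.
have -> : a' = a by apply: E; rewrite inE eqxx.
have -> : b' = a by apply: E; rewrite !inE eqxx orbT.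
by have -> : c' = a by apply: E; rewrite !inE eqxx !orbT.
Qed.

(** The coefficient to solve for once [v_j] and the coordinate [u] are 1: its own factor in the
    equation is a product of these two. *)
Definition pivot (j : 'I_n) (u : 'I_n + 'I_n + unit) : Midx n :=
  match u with
  | inl (inl a) => inl (inl a)
  | inl (inr a) => inl (inr (j, a))
  | inr _ => inr (j, j, j)
  end.

(* With [v_j] and [v2_k] the first nonzero coordinates, both scaled to 1, the
   coefficient [v2_k v_j + v2_j v_k] of [B(e_j, e_k)] is 1. *)
Lemma exists_pivot w : Yset w -> exists j u, exists Z : Pidx n -> R,
  [/\ Z (inl j) = 1, Z (inr u) = 1, solves w Z &
      \sum_(k | sym_eq k (pivot j u)) cf Z k = 1].
Proof.
move=> /YsetE[_ [X [Xv [u0 Xu0] wX]]].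
have [j Xj jmin] := exists_first_neq0 (X := fun j => X (inl j)) Xv.
have [Y [Yv Y0 wY]] := solves_rescale_v Xj wX.
suff [u Yu uP] : exists2 u, Y (inr u) != 0 &
    forall Z : Pidx n -> R, (forall a, Z (inl a) = Y (inl a)) ->
      (forall a, Z (inr a) = Y (inr a) / Y (inr u)) ->
      \sum_(k | sym_eq k (pivot j u)) cf Z k = 1.
  have [Z [Zv Zu wZ]] := solves_rescale_u Yu wY.
  exists j, u, Z; split=> //; last exact: uP.
    by rewrite Zv Yv divff.
  by rewrite Zu divff.
have [Yl|Yl] := eqVneq (Y (inr (inr tt))) 0; last first.
  exists (inr tt) => // Z Zv Zu; under eq_bigl do rewrite sym_eq_triple.
  by rewrite big_pred1_eq /cf /ix_lam /ix_v !Zv Zu Yv !divff// !mulr1.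
have [[b Yb]|Yv2] := pselect (exists b, Y (inr (inl (inr b))) != 0).
  have [b' Yb' b'min] := exists_first_neq0
    (X := fun b => Y (inr (inl (inr b)))) (ex_intro _ b Yb).
  exists (inl (inr b')) => // Z Zv Zu; under eq_bigl do rewrite sym_eq_pair.
  have [jb'|jb'] := eqVneq j b'.
    subst b'; under eq_bigl do rewrite orbb.
    rewrite big_pred1_eq /cf /ix_v2 /ix_v Zv Zu Yv !divff ?mulr1//.
  (* The class has two members, with factors [v2_j v_b'] and [v2_b' v_j = 1]. The first is 0: if
     [j < b'] then [v2_j = 0], and if [b' < j] then [v_b' = 0], by the two minimal choices. *)
  rewrite (bigD1 (inl (inr (j, b')))) ?eqxx//= (big_pred1 (inl (inr (b', j)))).
    rewrite /cf /ix_v2 /ix_v !Zv !Zu !Yv !divff// mulr1.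
    have [jltb'|] := ltnP j b'; first by rewrite b'min// !mul0r add0r.
    rewrite leq_eqVlt eq_sym (inj_eq val_inj) (negbTE jb') /= => b'ltj.
    by rewrite (jmin _ b'ltj) mul0r mulr0 add0r.
  move=> k /=; case: eqVneq => [->|]/=; last by rewrite andbT.
  by apply/esym/negbTE; apply: contra jb' => /eqP[->].
have [a Ya] : exists a, Y (inr (inl (inl a))) != 0.
  case: u0 Xu0 => [[a|a]|[]]; rewrite -Y0; first by exists a.
    by move=> Ya; exfalso; apply: Yv2; exists a.
  by rewrite Yl eqxx.
exists (inl (inl a)) => // Z Zv Zu; under eq_bigl do rewrite sym_eq_single.
by rewrite big_pred1_eq /cf /ix_v1 Zu divff.
Qed.

(** There is one chart per pair of normalized coordinates; independence on [Y] passes to one of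
    them, where [3 n + 1 - 2] parameters remain. *)
Lemma coord_indep_Yset_le (I : {set 'I_(Wdim n N)}) : (0 < n)%N ->
  coord_indep (@Yset R n N) I -> (#|I| + N <= #|Widx_sorted| + (3 * n - 1))%N.
Proof.
move=> n0.
pose T := ('I_n * ('I_n + 'I_n + unit))%type.
pose F (t : T) (p : Pidx n) : pexpr R #|Pidx n| :=
  if (p == inl t.1) || (p == inr t.2) then PConst 1 else PVar (enum_rank p).
pose S (t : T) : set 'rV[R]_(Wdim n N) := [set w | Wset w /\ exists x,
  \sum_(k | sym_eq k (pivot t.1 t.2)) peval (cfp (F t) k) x = 1 /\
  forall i, \sum_k wcoord w (i, k) * peval (cfp (F t) k) x = 0].
have YS : @Yset R n N `<=` \bigcup_t S t.
  move=> w Yw; have [j [u [Z [Zj Zu wZ Z1]]]] := exists_pivot Yw.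
  exists (j, u) => //; split; first by case: Yw.
  exists (\row_a Z (enum_val a)).
  have FZ k : peval (cfp (F (j, u)) k) (\row_a Z (enum_val a)) = cf Z k.
    rewrite peval_cfp; apply: eq_cf => p; rewrite /F /=.
    have [->|_] := eqVneq p (inl j); first by rewrite Zj.
    have [->|_] /= := eqVneq p (inr u); first by rewrite Zu.
    by rewrite mxE enum_rankK.
  split; first by rewrite -[RHS]Z1; apply: eq_bigr => k _.
  by move=> i; rewrite -[RHS](wZ i); apply: eq_bigr => k _; rewrite FZ.
move=> /(coord_indep_bigcup YS)[[j u] SI].
pose Q : {set 'I_#|Pidx n|} :=
  (~: [set enum_rank (inl j : Pidx n); enum_rank (inr u : Pidx n)])%SET.
have cQ : #|Q| = (3 * n - 1)%N.
  have := cardsC [set enum_rank (inl j : Pidx n); enum_rank (inr u : Pidx n)]%SET.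
  rewrite -/Q cards2 (inj_eq enum_rank_inj) /= => Q2.
  by apply: (@addnI 2); rewrite [LHS]Q2 card_ord [LHS]card_Pidx; lia.
rewrite -cQ; apply: coord_indep_chart SI => [k|w Sw]; last exact: Sw.
apply: pvars_in_cfp => p; rewrite /F /=; case: ifPn => //= pju.
by rewrite !inE !(inj_eq enum_rank_inj).
Qed.

End Dimension.

(** * Lower bound for the dimension of Y *)

(** Value, velocity and remainder, in the shape required by [coord_indep_tangent]. *)
Lemma horner_taylor2 (A : comNzRingType) (P : {poly A}) (h : A) :
  P.[h] = P`_0 + h * (P`_1 + h * (drop_poly 2 P).[h]).
Proof.
rewrite -[in LHS](poly_take_drop 2 P) hornerD hornerM hornerXn.
have -> : take_poly 2 P = (P`_0)%:P + (P`_1)%:P * 'X.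
  apply/polyP => i; rewrite coef_take_poly coefD coefC coefMX coefC.
  by case: i => [|[|i]] //=; rewrite ?addr0 ?add0r.
by rewrite hornerD hornerC hornerM hornerC hornerX; ring.
Qed.

Lemma coef1M (A : comNzRingType) (p q : {poly A}) :
  (p * q)`_1 = p`_0 * q`_1 + p`_1 * q`_0.
Proof. by rewrite coefM !big_ord_recl big_ord0 addr0. Qed.

Lemma sum_pred1 (A : pzRingType) (T : finType) (t : T) (F : T -> A) :
  \sum_u F u * (u == t)%:R = F t.
Proof.
rewrite (bigD1 t)//= eqxx mulr1 big1 ?addr0// => u /negbTE ->.
by rewrite mulr0.
Qed.

Lemma sum_triple (A : pzRingType) (S T U : finType) (F : S -> T -> U -> A) :
  \sum_(p : S * T * U) F p.1.1 p.1.2 p.2 = \sum_s \sum_t \sum_u F s t u.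
Proof. by rewrite pair_bigA pair_bigA. Qed.

Lemma sum_shift (A : pzRingType) (n m i : nat) (F : nat -> A) :
  \sum_(a < n) (i == m + a)%N%:R * F (m + a)%N =
  if (m <= i < m + n)%N then F i else 0.
Proof.
case: ifPn => [/andP[mi imn]|imn].
  have im : (i - m < n)%N by lia.
  rewrite (bigD1 (Ordinal im))//= subnKC// eqxx mul1r big1 ?addr0// => a aim.
  case: eqP => [ima|]; last by rewrite mul0r.
  by case/eqP: aim; apply: val_inj; rewrite /= ima addKn.
rewrite big1// => a _; case: eqP => [ima|]; last by rewrite mul0r.
by case/negP: imn; have := ltn_ord a; lia.
Qed.

Section LowerBound.
Variables (R : realType) (n N : nat) (o : 'I_n).
Hypothesis o0 : val o = 0%N.
Implicit Types (k : Midx n) (i : 'I_N).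

Definition k000 : Midx n := inr (o, o, o).

Lemma srt_k000 k : (srt k == k000) = (k == k000).
Proof.
rewrite -[LHS]/(srt k == inr (o, o, o)) -sym_eq_triple.
rewrite -[RHS]sym_eq_triple -[in RHS]srt_eq; apply/idP/eqP => [|->].
  by rewrite -srt_eq srt_id => /eqP.
exact: srtP.
Qed.

(* The base point is [L(e_a) = eps_a], [B(e_a, e_b) = eps_(n + a + b)],
   [T(e_a, e_b, e_c) = eps_(2 n - 1 + a + b + c)], except [T(e_0, e_0, e_0) = 0];
   it solves the equation with [v = e_0], [lam = 1], [v1 = v2 = 0]. *)
Definition base i k : R :=
  ((i + (size (key k) == 3))%N == ((size (key k)).-1 * n + sumn (key k))%N)%:R.

Lemma base_srt i k : base i (srt k) = base i k.
Proof. by rewrite /base (perm_size (srtP k)) (perm_sumn (srtP k)). Qed.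

Definition param0 (p : Pidx n) : R :=
  match p with
  | inl j => (j == o)%:R
  | inr (inl _) => 0
  | inr (inr _) => 1
  end.

Variable y : 'rV[R]_(Wdim n N).

Definition target (m : nat) : R :=
  if insub m is Some i then y 0 (rank_ik i k000) else 0.

(** Velocities of the unknowns that make [T(e_0, e_0, e_0)] move with the velocity given by [y]. The
    3 comes from differentiating [T(v, v, v)]; [v_0] and [lam] stay fixed. Terms such as [0 + j] are
    shaped for [sum_shift]. *)
Definition param1 (p : Pidx n) : R :=
  match p with
  | inl j => if (2 * n + j == 2 * n)%N then 0 else - target (2 * n + j).-1 / 3
  | inr (inl (inl j)) => - target (0 + j)
  | inr (inl (inr j)) => - target (n + j)
  | inr (inr _) => 0
  end.

Definition curve_param (p : Pidx n) : {poly R} := (param0 p)%:P + (param1 p)%:P * 'X.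

Lemma curve_param_coef0 p : (curve_param p)`_0 = param0 p.
Proof. by rewrite coefD coefC coefMX addr0. Qed.

Lemma curve_param_coef1 p : (curve_param p)`_1 = param1 p.
Proof. by rewrite coefD coefC coefMX coefC add0r. Qed.

Lemma horner_cf (X : Pidx n -> {poly R}) k h :
  (cf X k).[h] = cf (fun p => (X p).[h]) k.
Proof. by case: k => [[a|[a b]]|[[a b] c]] //=; rewrite !hornerM. Qed.

Lemma cf_curve_coef0 k : (cf curve_param k)`_0 = (k == k000)%:R.
Proof.
case: k => [[a|[a b]]|[[a b] c]]; rewrite /cf ?coef0M ?curve_param_coef0 /=.
- by [].
- by rewrite mul0r.
- rewrite mul1r -!natrM !mulnb -[inr _ == _]/((a, b, c) == (o, o, o)).
  by rewrite !xpair_eqE.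
Qed.

(** The product rule at the base point, where [v1 = v2 = 0], [v = e_0], [lam = 1] and [lam] has
    velocity 0. *)
Definition dcf k : R :=
  match k with
  | inl (inl a) => param1 (ix_v1 a)
  | inl (inr (a, b)) => param1 (ix_v2 a) * (b == o)%:R
  | inr (a, b, c) => param1 (ix_v a) * (b == o)%:R * (c == o)%:R +
      param1 (ix_v b) * (a == o)%:R * (c == o)%:R +
      param1 (ix_v c) * (a == o)%:R * (b == o)%:R
  end.

Lemma cf_curve_coef1 k : (cf curve_param k)`_1 = dcf k.
Proof.
case: k => [[a|[a b]]|[[a b] c]];
  rewrite /cf ?(coef1M, coef0M) ?(curve_param_coef1, curve_param_coef0) /=.
- by [].
- by rewrite mul0r add0r.
- by ring.
Qed.

Lemma sum_base_dcf i : (i < 3 * n - 1)%N ->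
  \sum_k base i k * dcf k = - y 0 (rank_ik i k000).
Proof.
move=> i3n; have tE : target i = y 0 (rank_ik i k000).
  by rewrite /target valK.
have sum1 : \sum_(a < n) base i (inl (inl a)) * dcf (inl (inl a)) =
    if (i < n)%N then - target i else 0.
  rewrite -(sum_shift n 0 i (fun m => - target m)); apply: eq_bigr => a _.
  by rewrite /base /= addn0 mul0n !add0n addn0.
have sum2 : \sum_(ab : 'I_n * 'I_n) base i (inl (inr ab)) * dcf (inl (inr ab)) =
    if (n <= i < n + n)%N then - target i else 0.
  rewrite -(sum_shift n n i (fun m => - target m)).
  transitivity (\sum_(a < n) \sum_(b < n)
      (base i (inl (inr (a, b))) * param1 (ix_v2 a)) * (b == o)%:R).
    by rewrite pair_bigA; apply: eq_bigr => -[a b] _ /=; rewrite mulrA.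
  apply: eq_bigr => a _; rewrite sum_pred1 /base /= o0 addn0 mul1n.
  by rewrite !addn0.
have sum3 : \sum_(abc : 'I_n * 'I_n * 'I_n) base i (inr abc) * dcf (inr abc) =
    if (2 * n <= i.+1 < 2 * n + n)%N then
      (if (i.+1 == 2 * n)%N then 0 else - target i) else 0.
  pose F (m : nat) := if (m == 2 * n)%N then 0 else - target m.-1 / 3.
  have FE : \sum_(a < n) (i.+1 == 2 * n + a)%N%:R * param1 (ix_v a) =
      if (2 * n <= i.+1 < 2 * n + n)%N then F i.+1 else 0.
    by rewrite -(sum_shift n (2 * n) i.+1 F).
  have bE (a : 'I_n) : (i.+1 == 2 * n + a)%N%:R = base i (inr (a, o, o)) :> R.
    by rewrite /base /= o0 addn1 !addn0.
  have symb (k k' : Midx n) : sym_eq k k' -> base i k = base i k'.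
    by rewrite -srt_eq => /eqP kk'; rewrite -base_srt kk' base_srt.
  (* By symmetry of [base] the three terms of the product rule have equal sums, which cancels the
     division by 3. *)
  transitivity (\sum_(a < n) (i.+1 == 2 * n + a)%N%:R * param1 (ix_v a) +
                \sum_(a < n) (i.+1 == 2 * n + a)%N%:R * param1 (ix_v a) +
                \sum_(a < n) (i.+1 == 2 * n + a)%N%:R * param1 (ix_v a)); last first.
    rewrite FE /F; case: ifP => // _; last by rewrite !addr0.
    by case: ifP => // _; [rewrite !addr0|rewrite /=; field].
  pose B a b c (d : 'I_n) := base i (inr (a, b, c)) * param1 (ix_v d).
  transitivity (\sum_(abc : 'I_n * 'I_n * 'I_n)
     (B abc.1.1 abc.1.2 abc.2 abc.1.1 * (abc.1.2 == o)%:R * (abc.2 == o)%:R +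
      B abc.1.1 abc.1.2 abc.2 abc.1.2 * (abc.1.1 == o)%:R * (abc.2 == o)%:R +
      B abc.1.1 abc.1.2 abc.2 abc.2 * (abc.1.1 == o)%:R * (abc.1.2 == o)%:R)).
    by apply: eq_bigr => -[[a b] c] _ /=; rewrite /B !mulrDr !mulrA.
  rewrite !big_split /=; congr (_ + _ + _).
  - rewrite (sum_triple (fun a b c => B a b c a * (b == o)%:R * (c == o)%:R)).
    apply: eq_bigr => a _; under eq_bigr do rewrite sum_pred1.
    by rewrite sum_pred1 bE.
  - rewrite (sum_triple (fun a b c => B a b c b * (a == o)%:R * (c == o)%:R)).
    rewrite exchange_big; apply: eq_bigr => b _ /=.
    under eq_bigr do rewrite sum_pred1; rewrite sum_pred1 bE; congr (_ * _).
    by apply: symb; apply/permP => p /=; rewrite addnCA.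
  - rewrite (sum_triple (fun a b c => B a b c c * (a == o)%:R * (b == o)%:R)).
    transitivity (\sum_(a < n) (\sum_(c < n) B a o c c) * (a == o)%:R).
      apply: eq_bigr => a _; rewrite exchange_big mulr_suml.
      by apply: eq_bigr => c _; rewrite sum_pred1.
    rewrite sum_pred1; apply: eq_bigr => c _; rewrite /B bE; congr (_ * _).
    by apply: symb; apply/permP => p /=; rewrite !addn0 addnA addnC.
rewrite big_sumType /= [X in X + _]big_sumType /= sum1 sum2 sum3 -tE.
(* Exactly one of [[0, n)], [[n, 2 n)], [[2 n, 3 n - 1)] contains [i]; the boundary [i = 2 n - 1]
   belongs to the second and contributes 0 to the third sum. *)
by case: ifP => i1; case: ifP => i2; case: ifP => i3; try case: ifP => i4;
  rewrite ?addr0 ?add0r//; exfalso; lia.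
Qed.

(** Reading [y] at [srt k] keeps the curve symmetric. *)
Definition curve_coef i k : {poly R} :=
  (base i k)%:P + (y 0 (rank_ik i (srt k)))%:P * 'X.

(** The equation solved for [T(e_0, e_0, e_0)], whose factor [lam v_0 ^ 3] is 1 all along the
    curve. *)
Definition curve_000 i : {poly R} :=
  - \sum_(k | k != k000) curve_coef i k * cf curve_param k.

Lemma curve_000_coef0 i : (curve_000 i)`_0 = 0.
Proof.
rewrite coefN coef_sum big1 ?oppr0// => k /negbTE k0.
by rewrite coef0M cf_curve_coef0 k0 mulr0.
Qed.

Lemma curve_000_coef1 i : (i < 3 * n - 1)%N ->
  (curve_000 i)`_1 = y 0 (rank_ik i k000).
Proof.
move=> i3n; rewrite coefN coef_sum -[RHS]opprK -sum_base_dcf//; congr (- _).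
rewrite [RHS](bigD1 k000)//= eqxx !mulr1.
rewrite o0 addn0 eqxx !addr0 mulr0 add0r; apply: eq_bigr => k /negbTE k0.
rewrite coef1M cf_curve_coef0 k0 mulr0 addr0 cf_curve_coef1.
by rewrite coefD coefC coefMX addr0.
Qed.

Definition curve_row (h : R) : 'rV[R]_(Wdim n N) :=
  \row_a let: (i, k) := enum_val a in
    if k == k000 then (curve_000 i).[h] else (curve_coef i k).[h].

Lemma curve_rowE h i k : wcoord (curve_row h) (i, k) =
  if k == k000 then (curve_000 i).[h] else (curve_coef i k).[h].
Proof. by rewrite /wcoord mxE enum_rankK. Qed.

Lemma curve_row_Yset h : Yset (curve_row h).
Proof.
apply/YsetE; split.
  apply/Wset_srt => i k; rewrite !curve_rowE srt_k000; case: ifP => // _.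
  by rewrite /curve_coef base_srt srt_id.
exists (fun p => (curve_param p).[h]); split.
- exists o; rewrite /curve_param /= eqxx o0 addn0 eqxx mul0r addr0 hornerC.
  exact: oner_neq0.
- exists (inr tt); rewrite /curve_param /= mul0r addr0 hornerC.
  exact: oner_neq0.
- move=> i; rewrite (bigD1 k000)//= curve_rowE eqxx.
  rewrite /curve_param /ix_lam /ix_v /= eqxx o0 addn0 eqxx !mul0r !addr0 hornerC !mulr1.
  rewrite /curve_000 hornerN horner_sum addrC; apply/eqP; rewrite subr_eq0; apply/eqP.
  apply: eq_bigr => k /negbTE k0; rewrite curve_rowE k0 hornerM horner_cf.
  by [].
Qed.

End LowerBound.

Section LowerBoundDim.
Variables (R : realType) (n N : nat).

Lemma coord_indep_Yset_ge : (0 < n)%N -> (3 * n <= N)%N ->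
  exists2 I, coord_indep (@Yset R n N) I &
    (#|Widx_sorted n N| + (3 * n - 1) - N <= #|I|)%N.
Proof.
move=> n0 nN; pose o : 'I_n := Ordinal n0.
have mN : (3 * n - 1 <= N)%N by lia.
(* These are the components [i >= 3 n - 1] of [T(e_0, e_0, e_0)], whose velocity [param1] does not
   prescribe. *)
pose r (t : 'I_(N - (3 * n - 1))) : 'I_(Wdim n N) :=
  rank_ik (cast_ord (subnKC mN) (rshift _ t)) (k000 o).
pose I0 := (Widx_sorted n N :\: (r @: 'I__))%SET.
exists I0; last first.
  rewrite /I0 cardsD.
  have : (#|Widx_sorted n N :&: r @: 'I__|%SET <= N - (3 * n - 1))%N.
    apply: leq_trans (subset_leq_card (finset.subsetIr _ _)) _.
    by apply: leq_trans (leq_imset_card _ _) _; rewrite card_ord.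
  by move: #|_| #|_| => x z; lia.
apply: (@coord_indep_tangent _ _ _ _ (\row_a let: (i, k) := enum_val a in
  if k == k000 o then 0 else base R i k)) => y.
exists (fun a => let: (i, k) := enum_val a in
  if k == k000 o then drop_poly 2 (curve_000 o y i) else 0) => h.
exists (curve_row o y h); split; first exact: curve_row_Yset.
move=> a; have [i [k ->]] := rank_ik_surj a.
rewrite /I0 !inE enum_rankK /= => /andP[ir /eqP ksrt].
rewrite -[LHS]/(wcoord _ _) curve_rowE mxE enum_rankK.
case: eqP => [k0|_].
  have i3n : (i < 3 * n - 1)%N.
    rewrite ltnNge; apply: contra ir => i3n; rewrite k0.
    have iN : (i - (3 * n - 1) < N - (3 * n - 1))%N by have := ltn_ord i; lia.
    apply/imsetP; exists (Ordinal iN) => //; congr (rank_ik _ _).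
    by apply: val_inj; rewrite /= subnKC.
  by rewrite horner_taylor2 curve_000_coef0 curve_000_coef1// k0.
rewrite horner0 mulr0 addr0 /curve_coef ksrt.
by rewrite hornerD hornerM hornerX !hornerC mulrC.
Qed.

Lemma sa_dim_Yset : (0 < n)%N -> (3 * n <= N)%N ->
  sa_dim (@Yset R n N) = (#|Widx_sorted n N| + (3 * n - 1) - N)%N.
Proof.
move=> n0 nN; apply: sa_dim_unique; first exact: coord_indep_Yset_ge.
by move=> I /(coord_indep_Yset_le n0); lia.
Qed.

(** Ensures that the truncated subtraction of [N] in [sa_dim_Yset] is exact. *)
Lemma leq_N_sorted : (0 < n)%N -> (N <= #|Widx_sorted n N|)%N.
Proof.
move=> n0; pose o : 'I_n := Ordinal n0.
rewrite -[leqLHS]card_ord.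
rewrite -(card_imset 'I_N (f := fun i => rank_ik i (k000 o))); last first.
  by move=> i i' /rank_ik_inj[].
apply: subset_leq_card; apply/fintype.subsetP => _ /imsetP[i _ ->].
by rewrite rank_ik_sorted srt_k000.
Qed.

End LowerBoundDim.

Theorem theorem4p2 (R : realType) (n N : nat) :
  (1 <= n)%N -> (3 * n <= N)%N ->
  semialgebraic (@Yset R n N) /\ closed (@Yset R n N) /\
  sa_dim (@Wset R n N) = (sa_dim (@Yset R n N) + (N - 3 * n + 1))%N.
Proof.
move=> n0 nN; split; first exact: semialgebraic_Yset.
split; first exact: closed_Yset.
rewrite sa_dim_Wset sa_dim_Yset//.
by have := leq_N_sorted N n0; lia.
Qed.
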